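(* Let $\mathcal G=(\mathcal V,\mathcal E)$ be a finite simple graph and let $(M_v,\tau_v)$, $v\in\mathcal V$, be a family of tracial von Neumann algebras. If each $(M_v,\tau_v)$ is algebraically sofic, then so is the graph product of $(M_v,\tau_v)_{v\in\mathcal V}$ over $\mathcal G$.
   Context: A tracial von Neumann algebra $(M,\tau)$ is a von Neumann algebra with a faithful normal tracial state. A finite simple graph has finite vertex set $\mathcal V$ and edge set $\mathcal E\subseteq\mathcal V\times\mathcal V$ symmetric and containing no $(v,v)$. Graph product: a word $(v_1,\dots,v_n)\in\mathcal V^n$ is $\mathcal G$-reduced if whenever $i<k$ and $v_i=v_k$, there is $j$ with $i<j<k$ and $(v_i,v_j)\notin\mathcal E$. Von Neumann subalgebras $(M_v)_{v\in\mathcal V}$ of $(M,\tau)$ are $\mathcal G$-independent if $M_v$ and $M_w$ commute whenever $(v,w)\in\mathcal E$, and $\tau(x_1\cdots x_n)=0$ whenever $n\ge1$, $(v_1,\dots,v_n)$ is $\mathcal G$-reduced, $x_i\in M_{v_i}$ and $\tau(x_i)=0$ for all $i$. The graph product is the (unique) tracial von Neumann algebra $(M,\tau)$ generated by $\mathcal G$-independent copies of the $M_v$ with $\tau|_{M_v}=\tau_v$. Algebraic soficity: let $\mathrm{tr}_n$ be the normalized trace on $M_n(\mathbb C)$, $\|a\|_2=\mathrm{tr}_n(a^*a)^{1/2}$, and let $\mathrm{Gal}(\overline{\mathbb Q}/\mathbb Q)$ be the group of all field automorphisms of the field $\overline{\mathbb Q}\subseteq\mathbb C$ of algebraic numbers,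 acting entrywise on matrices. A sequence $X^{(k)}\in M_{n(k)}(\mathbb C)$ is Galois bounded if all entries of all $X^{(k)}$ are algebraic integers, $\sup_k\max_{\sigma\in\mathrm{Gal}(\overline{\mathbb Q}/\mathbb Q)}\|\sigma(X^{(k)})\|<\infty$, and $\sup_k\#\{\sigma(X^{(k)}):\sigma\in\mathrm{Gal}(\overline{\mathbb Q}/\mathbb Q)\}<\infty$; a sequence of finite tuples is Galois bounded if each coordinate sequence is. Matrices $X^{(k)}\in M_{n(k)}(\mathbb C)^F$ ($F$ finite) are microstates for $x\in M^F$ if $\mathrm{tr}_{n(k)}(P(X^{(k)}))\to\tau(P(x))$ for every noncommutative $*$-polynomial $P$ over $\mathbb C$. A sequence $Y^{(k)}\in M_{n(k)}(\mathbb C)$ is asymptotically constant on the diagonal if $\|\Delta_{n(k)}(Y^{(k)})-\mathrm{tr}_{n(k)}(Y^{(k)})1\|_2\to0$, where $\Delta_n$ is the conditional expectation onto the diagonal matrices. A tuple $x=(x_i)_{i\in I}\in M^I$ ($I$ any set) is algebraically sofic if for every finite $F\subseteq I$ there is a Galois bounded sequence of microstates $X^{(k)}=(X_i^{(k)})_{i\in F}$ for $x|_F$ such that $P(X^{(k)})$ is asymptotically constant on the diagonal for every $*$-polynomial $P$. $(M,\tau)$ is algebraically sofic if it has an algebraically sofic tuple generating it as a von Neumann algebra. *)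

(* Defs.v *)
(* Built on MathComp and MathComp-Analysis; R[i] is the field of complex
   numbers. *)
From HB Require Import structures.
From mathcomp Require Import all_boot all_order all_algebra.
From mathcomp Require Import sesquilinear spectral complex.
From mathcomp Require Import all_classical all_reals all_analysis.

Set Implicit Arguments.
Unset Strict Implicit.
Unset Printing Implicit Defensive.

Import Order.TTheory GRing.Theory Num.Theory.
Import numFieldNormedType.Exports.

Local Open Scope classical_set_scope.
Local Open Scope ring_scope.
Local Open Scope sesquilinear_scope.
Local Open Scope complex_scope.

HB.instance Definition _ (R : realType) := NormedModule.copy R[i] R[i]^o.

(* A form of type {dot U for Num.conj} is linear in its first argument and
   conjugate-linear in the second one. *)
Definition dot_norm (R : realType) (U : lmodType R[i])
    (dot : {dot U for (@Num.conj R[i])}) (x : U) : R :=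
  Num.sqrt (complex.Re (dot x x)).

Definition dot_complete (R : realType) (U : lmodType R[i])
    (dot : {dot U for (@Num.conj R[i])}) : Prop :=
  forall u : nat -> U,
    (forall eps : R, 0 < eps -> exists N : nat, forall m n : nat,
       (N <= m)%N -> (N <= n)%N -> dot_norm dot (u m - u n) < eps) ->
    exists l : U, dot_norm dot (u n - l) @[n --> \oo] --> (0 : R).

Record hilbertSpace (R : realType) := HilbertSpace {
  hcarrier :> lmodType R[i];
  hdot : {dot hcarrier for (@Num.conj R[i])};
  hdot_complete : dot_complete hdot
}.

Definition hnorm (R : realType) (H : hilbertSpace R) (x : H) : R :=
  dot_norm (hdot H) x.

(* B(H).  Operators are plain functions H -> H; sums and scalar multiples of
   operators are the pointwise ones, products are compositions. *)
Definition bounded_op (R : realType) (H : hilbertSpace R) : set (H -> H) :=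
  [set T | linear T /\ exists K : R, forall x : H, hnorm (T x) <= K * hnorm x].

(* The default value [idfun] is never reached for T in B(H), by the Riesz
   representation theorem. *)
Definition adjoint (R : realType) (H : hilbertSpace R) (T : H -> H) : H -> H :=
  xget (idfun : H -> H)
    [set S : H -> H | forall x y : H, hdot H (T x) y = hdot H x (S y)].

(* Ultraweak (= sigma-weak = weak-star) topology on B(H): the weakest topology
    making T |-> sum_n <T xi_n, eta_n> continuous for all square-summable
    sequences xi and eta of vectors. *)

Definition square_summable (R : realType) (H : hilbertSpace R)
    (xi : nat -> H) : Prop :=
  cvgn (series (fun n => hnorm (xi n) ^+ 2)).

Definition uw_functional (R : realType) (H : hilbertSpace R)
    (xi eta : nat -> H) (T : H -> H) : R[i] :=
  limn (series (fun n => hdot H (T (xi n)) (eta n))).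

Definition uw_cvg (R : realType) (H : hilbertSpace R)
    (F : set_system (H -> H)) (T : H -> H) : Prop :=
  forall xi eta : nat -> H, square_summable xi -> square_summable eta ->
    uw_functional xi eta @ F --> uw_functional xi eta T.

Definition uw_closed (R : realType) (H : hilbertSpace R)
    (M : set (H -> H)) : Prop :=
  forall (F : set_system (H -> H)) (T : H -> H),
    ProperFilter F -> F M -> bounded_op T -> uw_cvg F T -> M T.

Record von_neumann_algebra (R : realType) (H : hilbertSpace R)
    (M : set (H -> H)) : Prop := VonNeumannAlgebra {
  vna_bounded : M `<=` @bounded_op R H;
  vna_one : M idfun;
  vna_linear : forall (a : R[i]) (S T : H -> H), M S -> M T -> M (a *: S + T);
  vna_mul : forall S T : H -> H, M S -> M T -> M (S \o T);
  vna_adjoint : forall T : H -> H, M T -> M (adjoint T);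
  vna_closed : uw_closed M
}.

Definition vN_generates (R : realType) (H : hilbertSpace R)
    (S M : set (H -> H)) : Prop :=
  S `<=` M /\
  forall N : set (H -> H), von_neumann_algebra N -> S `<=` N -> M `<=` N.

(* Only the values of [tau] on M matter. *)
Record faithful_normal_tracial_state (R : realType) (H : hilbertSpace R)
    (M : set (H -> H)) (tau : (H -> H) -> R[i]) : Prop :=
  FaithfulNormalTracialState {
  tr_linear : forall (a : R[i]) (S T : H -> H), M S -> M T ->
    tau (a *: S + T) = a * tau S + tau T;
  tr_one : tau idfun = 1;
  tr_ge0 : forall T : H -> H, M T -> 0 <= tau (adjoint T \o T);
  tr_faithful : forall T : H -> H, M T -> tau (adjoint T \o T) = 0 -> T = 0;
  tr_tracial : forall S T : H -> H, M S -> M T -> tau (S \o T) = tau (T \o S);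
  tr_normal : forall (F : set_system (H -> H)) (T : H -> H),
    ProperFilter F -> F M -> M T -> uw_cvg F T -> tau @ F --> tau T
}.

Record tracialVN (R : realType) := TracialVN {
  tvn_space : hilbertSpace R;
  tvn_alg : set (tvn_space -> tvn_space);
  tvn_trace : (tvn_space -> tvn_space) -> R[i];
  tvn_algP : von_neumann_algebra tvn_alg;
  tvn_traceP : faithful_normal_tracial_state tvn_alg tvn_trace
}.

Arguments tvn_alg {R} M : rename.
Arguments tvn_trace {R} M : rename.

Definition reduced_word (V : finType) (e : rel V) (n : nat) (v : 'I_n -> V) :
    Prop :=
  forall i k : 'I_n, (i < k)%N -> v i = v k ->
    exists j : 'I_n, (i < j < k)%N /\ ~~ e (v i) (v j).

Record graph_independent (R : realType) (V : finType) (e : rel V)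
    (M : tracialVN R)
    (N : V -> set (tvn_space M -> tvn_space M)) : Prop := GraphIndependent {
  gi_vN : forall v : V, von_neumann_algebra (N v);
  gi_sub : forall v : V, N v `<=` tvn_alg M;
  gi_comm : forall (v w : V) (S T : tvn_space M -> tvn_space M),
    e v w -> N v S -> N w T -> S \o T = T \o S;
  gi_trace : forall (n : nat) (v : 'I_n -> V)
      (x : 'I_n -> (tvn_space M -> tvn_space M)),
    (0 < n)%N -> reduced_word e v ->
    (forall i : 'I_n, N (v i) (x i) /\ tvn_trace M (x i) = 0) ->
    tvn_trace M (\big[(fun S T => S \o T)/idfun]_(i < n) x i) = 0
}.

(* [iota] is a normal trace-preserving *-isomorphism of M onto the von Neumann
   subalgebra N of M'.  Normality is automatic for *-isomorphisms of von Neumann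
   algebras; it is recorded here as part of the notion. *)
Record tracial_isomorphism_onto (R : realType) (M M' : tracialVN R)
    (N : set (tvn_space M' -> tvn_space M'))
    (iota : (tvn_space M -> tvn_space M) -> (tvn_space M' -> tvn_space M')) :
    Prop := TracialIsomorphismOnto {
  ti_bij : set_bij (tvn_alg M) N iota;
  ti_linear : forall (a : R[i]) (S T : tvn_space M -> tvn_space M),
    tvn_alg M S -> tvn_alg M T -> iota (a *: S + T) = a *: iota S + iota T;
  ti_one : iota idfun = idfun;
  ti_mul : forall S T : tvn_space M -> tvn_space M,
    tvn_alg M S -> tvn_alg M T -> iota (S \o T) = iota S \o iota T;
  ti_adjoint : forall T : tvn_space M -> tvn_space M,
    tvn_alg M T -> iota (adjoint T) = adjoint (iota T);
  ti_normal : forall (F : set_system (tvn_space M -> tvn_space M))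
      (T : tvn_space M -> tvn_space M),
    ProperFilter F -> F (tvn_alg M) -> tvn_alg M T -> uw_cvg F T ->
    uw_cvg (iota @ F) (iota T);
  ti_trace : forall T : tvn_space M -> tvn_space M,
    tvn_alg M T -> tvn_trace M' (iota T) = tvn_trace M T
}.

(* The graph product is determined up to trace-preserving isomorphism only;
   the predicate says that M is a model of it. *)
Definition is_graph_product (R : realType) (V : finType) (e : rel V)
    (Mv : V -> tracialVN R) (M : tracialVN R) : Prop :=
  exists (N : V -> set (tvn_space M -> tvn_space M))
    (iota : forall v : V, (tvn_space (Mv v) -> tvn_space (Mv v)) ->
                          (tvn_space M -> tvn_space M)),
    [/\ graph_independent e N,
        forall v : V, tracial_isomorphism_onto (N v) (iota v) &
        vN_generates (\bigcup_(v in [set: V]) N v) (tvn_alg M)].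

(* A *-polynomial in indeterminates indexed by I is a finite sum of terms
   c * w, with w a word in the letters (i, false) = X_i, (i, true) = X_i^*. *)
Definition ncpoly (C I : Type) : Type := seq (C * seq (I * bool)).

Definition ncpoly_eval (C : nzRingType) (A : lmodType C) (one : A)
    (mul : A -> A -> A) (star : A -> A) (I : Type) (x : I -> A)
    (P : ncpoly C I) : A :=
  \sum_(m <- P)
    m.1 *: foldr mul one [seq (if l.2 then star (x l.1) else x l.1) | l <- m.2].

Definition ncpoly_op (R : realType) (H : hilbertSpace R) (I : Type)
    (x : I -> (H -> H)) (P : ncpoly R[i] I) : H -> H :=
  ncpoly_eval (idfun : H -> H) (fun S T => S \o T) (@adjoint R H) x P.

Definition ncpoly_mx (R : realType) (n : nat) (I : Type)
    (X : I -> 'M[R[i]]_n) (P : ncpoly R[i] I) : 'M[R[i]]_n :=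
  ncpoly_eval 1%:M (fun A B => A *m B) (fun A => A ^t*) X P.

Definition ntr (R : realType) (n : nat) (A : 'M[R[i]]_n) : R[i] :=
  \tr A / n%:R.

Definition norm2 (R : realType) (n : nat) (A : 'M[R[i]]_n) : R :=
  Num.sqrt (complex.Re (ntr (A ^t* *m A))).

Definition euclidean_norm (R : realType) (n : nat) (v : 'cV[R[i]]_n) : R :=
  Num.sqrt (complex.Re ((v ^t* *m v) 0 0)).

Definition mx_opnorm (R : realType) (n : nat) (A : 'M[R[i]]_n) : R :=
  sup [set euclidean_norm (A *m v) | v in [set v | euclidean_norm v <= 1]].

Definition diag_part (R : realType) (n : nat) (A : 'M[R[i]]_n) : 'M[R[i]]_n :=
  diag_mx (\row_j A j j).

Definition algebraic_numbers (R : realType) : set R[i] :=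
  [set z | algebraicOver (@ratr R[i]) z].

Definition algebraic_integer (R : realType) (z : R[i]) : Prop :=
  integralOver (intr : int -> R[i]) z.

(* Elements of Gal(Qbar/Q) are represented by functions defined on all of C;
   only their restriction to Qbar is constrained, and used. *)
Definition galois_Qbar (R : realType) : set (R[i] -> R[i]) :=
  [set sigma | [/\ set_bij (@algebraic_numbers R) (@algebraic_numbers R) sigma,
     sigma 1 = 1,
     (forall x y : R[i], algebraic_numbers x -> algebraic_numbers y ->
        sigma (x + y) = sigma x + sigma y) &
     (forall x y : R[i], algebraic_numbers x -> algebraic_numbers y ->
        sigma (x * y) = sigma x * sigma y)]].

Definition galois_bounded (R : realType) (n : nat -> nat)
    (X : forall k : nat, 'M[R[i]]_(n k)) : Prop :=
  [/\ forall (k : nat) (i j : 'I_(n k)), algebraic_integer (X k i j),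
      exists K : R, forall (k : nat) (sigma : R[i] -> R[i]),
        galois_Qbar sigma -> mx_opnorm (map_mx sigma (X k)) <= K &
      exists K : nat, forall k : nat,
        ([set map_mx sigma (X k) | sigma in @galois_Qbar R] #<= `I_K)%card].

Definition microstates (R : realType) (M : tracialVN R) (F : Type)
    (x : F -> (tvn_space M -> tvn_space M)) (n : nat -> nat)
    (X : forall k : nat, F -> 'M[R[i]]_(n k)) : Prop :=
  forall P : ncpoly R[i] F,
    ntr (ncpoly_mx (X k) P) @[k --> \oo] --> tvn_trace M (ncpoly_op x P).

Definition asymptotically_constant_on_diagonal (R : realType) (n : nat -> nat)
    (Y : forall k : nat, 'M[R[i]]_(n k)) : Prop :=
  norm2 (diag_part (Y k) - (ntr (Y k))%:M) @[k --> \oo] --> (0 : R).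

(* The finite subset F of I is used as a type, through its coercion to
   [set_type F]. *)
Definition algebraically_sofic_tuple (R : realType) (M : tracialVN R)
    (I : Type) (x : I -> (tvn_space M -> tvn_space M)) : Prop :=
  forall F : set I, finite_set F ->
    exists (n : nat -> nat) (X : forall k : nat, F -> 'M[R[i]]_(n k)),
      [/\ forall k : nat, (0 < n k)%N,
          forall i : F, galois_bounded (fun k => X k i),
          microstates (fun i : F => x (val i)) X &
          forall P : ncpoly R[i] F,
            asymptotically_constant_on_diagonal (fun k => ncpoly_mx (X k) P)].

Definition algebraically_sofic (R : realType) (M : tracialVN R) : Prop :=
  exists (I : Type) (x : I -> (tvn_space M -> tvn_space M)),
    [/\ forall i : I, tvn_alg M (x i),
        vN_generates (range x) (tvn_alg M) &
        algebraically_sofic_tuple x].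

(* Main.v *)
Require Import Defs.
From mathcomp Require Import all_boot all_order all_algebra all_fingroup.
From mathcomp Require Import sesquilinear complex.
From mathcomp Require Import all_classical all_reals all_analysis.
From mathcomp Require Import ring lra.

(* Let G = Z/N with N a common multiple of the sizes of the given microstates.  There
   is a finite group containing one copy G_v of G per vertex, where adjacent
   copies commute and nonempty reduced words of length at most k are nontrivial,
   together with homomorphisms to G recording, for each v, the total exponent of
   v.  Residual finiteness is obtained one word at a time: for a reduced word
   g_1 ... g_l, let the state consist of one counter per vertex, and let G_v act
   on the counter of v in a way that depends only on the counters of the vertices
   not adjacent to v (so adjacent copies commute automatically), rigged so that
   g_i increments the counter of its vertex when the word is read from the
   initial state.

   An n x n matrix A placed at v acts on the l^2 space of this group by moving
   along G_v with coefficients A; this is an amplification of A up to a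
   permutation of the basis, so it keeps traces, norms and Galois orbits.  Since a
   product of off-diagonal matrices along a reduced word only moves along closed
   paths spelling a nontrivial group element, its diagonal vanishes.  Asymptotic
   constancy on the diagonal says that a centered matrix is off-diagonal up to a
   small error in 2-norm, which gives graph independence in the limit. *)

Set Implicit Arguments.
Unset Strict Implicit.
Unset Printing Implicit Defensive.

Import Order.TTheory GRing.Theory Num.Theory.
Import numFieldNormedType.Exports.

(** * Walks without reduced loops *)

Section Reduced.
Variables (V : finType) (e : rel V).

(** Fails exactly when the first letter of [s] not adjacent to [v] is [v] itself, so that the two
    could be commuted together and merged. *)
Fixpoint head_free (v : V) (s : seq V) : bool :=
  if s is u :: s' then (if e v u then head_free v s' else u != v) else true.

Fixpoint greduced (s : seq V) : bool :=
  if s is v :: s' then head_free v s' && greduced s' else true.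

Hypothesis e_irr : irreflexive e.

Lemma head_free_nth (x0 v : V) (s : seq V) (k : nat) :
  head_free v s -> k < size s -> nth x0 s k = v ->
  exists j, [/\ j < k, nth x0 s j != v & ~~ e v (nth x0 s j)].
Proof.
elim: s k => [|u s IH] // [|k] /=.
  by case: ifP => [evu _ _ uv | _ /negP + _ /eqP //]; rewrite uv e_irr in evu.
case: ifP => [_ hf ks nk | /negbT evu uv _ _]; last by exists 0.
by have [j [jk nj ej]] := IH k hf ks nk; exists j.+1.
Qed.

(** The separating letter is the first one not adjacent to the repeated letter. It is distinct from
    it, which is more than [reduced_word] asks and is what [context_inj] needs. *)
Lemma greduced_nth (x0 : V) (s : seq V) (i k : nat) :
  greduced s -> i < k -> k < size s -> nth x0 s i = nth x0 s k ->
  exists j, [/\ i < j < k, nth x0 s j != nth x0 s i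
              & ~~ e (nth x0 s i) (nth x0 s j)].
Proof.
elim: s i k => [|v s IH] // [|i] [|k] //= /andP[hf gs] ik ks eq_ik.
  have [j [jk nj ej]] := head_free_nth hf ks (esym eq_ik).
  by exists j.+1.
by have [j [? ? ?]] := IH i k gs ik ks eq_ik; exists j.+1.
Qed.

Lemma head_free_mapPn (T : Type) (f : T -> V) (v : V) (s : seq T) :
  ~~ head_free v (map f s) ->
  exists s1 a s2, [/\ s = s1 ++ a :: s2, f a = v & all (fun b => e v (f b)) s1].
Proof.
elim: s => [|a s IH] //=; case: ifP => [eva /IH [s1 [b [s2 [-> fb s1v]]]] | _].
  by exists (a :: s1), b, s2; rewrite /= eva.
by move=> /negPn/eqP fa; exists [::], a, s.
Qed.

(** The two letters over the same vertex can be brought together across [s2]; this is how a word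
    gets shorter in [graph_word_ind]. *)
Lemma greduced_mapPn (T : Type) (f : T -> V) (s : seq T) : ~~ greduced (map f s) ->
  exists s1 a s2 b s3, [/\ s = s1 ++ a :: s2 ++ b :: s3, f b = f a
                         & all (fun c => e (f a) (f c)) s2].
Proof.
elim: s => [|a s IH] //=; rewrite negb_and.
case/orP => [/head_free_mapPn [s2 [b [s3 [-> fb s2v]]]] |].
  by exists [::], a, s2, b, s3.
by move=> /IH [s1 [b [s2 [c [s3 [-> fc h]]]]]]; exists (a :: s1), b, s2, c, s3.
Qed.
End Reduced.

(** * Actions that detect a given reduced word *)

Section WordAction.
Variables (V : finType) (e : rel V) (N r : nat).
Hypotheses (e_sym : symmetric e) (e_irr : irreflexive e).
Local Notation G := 'I_N.+1.
Local Notation C := (G * 'I_r.+1)%type.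
Local Notation state := {ffun V -> C}.
Local Notation word := (seq (V * G)).

Definition occurrences (w : word) (i : nat) (u : V) : nat :=
  count_mem u (map fst (take i w)).

(** The intended state after [i] letters have been read. The second component is the count, and
    [inord] loses nothing once [size w <= r]; the first is a copy of [G] for the shift to act on. *)
Definition word_state (w : word) (i : nat) : state :=
  [ffun u => (0%R, inord (occurrences w i u))].

(* The position of [w], if any, at which [v] is read while the counters of the
   other vertices not adjacent to [v] are as in [f]; it is unique when [w] is
   reduced. *)
Definition word_slot (w : word) (v : V) (f : state) : option 'I_(size w) :=
  [pick i : 'I_(size w) | ((nth (v, 0%R) w i).1 == v) &&
     [forall u, (u != v) ==> ~~ e v u ==> (f u == word_state w i u)]].

(* Conjugating the shift by this involution makes the letter of the slot send
   its counter from [(0, c)] to [(0, c + 1)]. *)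
Definition twist (w : word) (v : V) (f : state) : {perm C} :=
  if word_slot w v f is Some i then
    tperm ((nth (v, 0%R) w i).2, inord (occurrences w i v))
          (0%R, inord (occurrences w i v).+1)
  else 1%g.

Definition shift (g : G) (c : C) : C := ((c.1 + g)%R, c.2).

Definition word_act (w : word) (v : V) (g : G) (f : state) : state :=
  [ffun u => if u == v then twist w v f (shift g (twist w v f (f v))) else f u].

Lemma twistK w v f : involutive (twist w v f).
Proof. by move=> c; rewrite /twist; case: word_slot => [i|]; rewrite ?tpermK ?perm1. Qed.

Lemma word_act_id w v g f : word_act w v g f v = twist w v f (shift g (twist w v f (f v))).
Proof. by rewrite ffunE eqxx. Qed.

Lemma word_act_neq w v g f u : u != v -> word_act w v g f u = f u.
Proof. by rewrite ffunE => /negbTE ->. Qed.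

(** The slot of [u] depends only on the counters of other vertices not adjacent to [u], and acting
    at [v] changes the counter of [v] alone. The case [u = v] makes the action additive, the
    adjacent case makes two actions commute. *)
Lemma twist_act w u v g f : (u == v) || e u v ->
  twist w u (word_act w v g f) = twist w u f.
Proof.
move=> uv; rewrite /twist /word_slot.
under eq_pick => i.
  under eq_forallb => x.
    have -> : ((x != u) ==> ~~ e u x ==> (word_act w v g f x == word_state w i x))
            = ((x != u) ==> ~~ e u x ==> (f x == word_state w i x)).
      case: (eqVneq x u) => //= xu; case: (boolP (e u x)) => //= eux.
      rewrite word_act_neq //; apply: contraNneq eux => xv.
      by move: uv; rewrite -xv eq_sym (negbTE xu).
    over.
  over.
by [].
Qed.

Lemma word_actD w v g h f : word_act w v h (word_act w v g f) = word_act w v (g + h)%R f.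
Proof.
apply/ffunP => u; have [->|uv] := eqVneq u v; last by rewrite !word_act_neq.
rewrite !word_act_id twist_act ?eqxx // twistK /shift /=.
by rewrite addrA.
Qed.

Lemma word_act0 w v f : word_act w v 0%R f = f.
Proof.
apply/ffunP => u; have [->|uv] := eqVneq u v; last by rewrite !word_act_neq.
by rewrite word_act_id /shift addr0 -surjective_pairing twistK.
Qed.

Lemma word_actC w u v g h f : e u v ->
  word_act w u g (word_act w v h f) = word_act w v h (word_act w u g f).
Proof.
move=> uv; have nuv : u != v by apply: contraTneq uv => ->; rewrite e_irr.
apply/ffunP => x; have [->|xu] := eqVneq x u.
  rewrite [RHS]word_act_neq // !word_act_id twist_act ?uv ?orbT //.
  by rewrite word_act_neq.
rewrite word_act_neq //; have [->|xv] := eqVneq x v; last by rewrite !word_act_neq.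
rewrite !word_act_id twist_act; last by rewrite e_sym uv orbT.
by rewrite word_act_neq // eq_sym.
Qed.

Lemma occurrencesS x0 w j u : j < size w ->
  occurrences w j.+1 u = occurrences w j u + ((nth x0 w j).1 == u).
Proof.
by move=> jw; rewrite /occurrences (take_nth x0 jw) map_rcons -cats1 count_cat /= addn0.
Qed.

Lemma occurrences_le w i k u : i <= k -> occurrences w i u <= occurrences w k u.
Proof.
move=> ik; rewrite /occurrences -(take_takel w ik).
by rewrite -[in leqRHS](cat_take_drop i (take k w)) map_cat count_cat leq_addr.
Qed.

Lemma occurrences_lt x0 w i k j : i <= j < k -> j < size w ->
  occurrences w i (nth x0 w j).1 < occurrences w k (nth x0 w j).1.
Proof.
move=> /andP[ij jk] jw; apply: leq_trans (occurrences_le w _ jk).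
by rewrite (occurrencesS x0) // eqxx addn1 ltnS occurrences_le.
Qed.

Lemma occurrences_bound w i u : size w <= r -> occurrences w i u < r.+1.
Proof.
move=> wr; rewrite ltnS; apply: leq_trans wr; rewrite /occurrences.
by rewrite (leq_trans (count_size _ _)) // size_map size_take_min geq_minr.
Qed.

Lemma word_state_eq w i k u : size w <= r ->
  (word_state w i u == word_state w k u) = (occurrences w i u == occurrences w k u).
Proof.
move=> wr; rewrite !ffunE xpair_eqE eqxx /= -(inj_eq val_inj) /=.
by rewrite !inordK // occurrences_bound.
Qed.

(** Between two readings of [v] some other letter not adjacent to [v] is read, and its count has
    grown by the second reading. *)
Lemma context_inj w (v : V) (i k : nat) :
  greduced e (map fst w) -> size w <= r -> i < k -> k < size w ->
  (nth (v, 0%R) w i).1 = v -> (nth (v, 0%R) w k).1 = v ->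
  exists u, [/\ u != v, ~~ e v u & word_state w i u != word_state w k u].
Proof.
move=> wred wr ik kw wi wk; have iw := ltn_trans ik kw.
have nthE j : j < size w -> nth v (map fst w) j = (nth (v, 0%R) w j).1.
  by move=> jw; rewrite (nth_map (v, 0%R)).
have := @greduced_nth _ _ e_irr v _ i k wred ik; rewrite size_map !nthE // wi wk.
move=> /(_ kw erefl) [j [/andP[ij jk]]]; have jw := ltn_trans jk kw.
rewrite nthE // => nv ev; exists (nth (v, 0%R) w j).1; split=> //.
by rewrite word_state_eq // ltn_eqF // occurrences_lt // (ltnW ij).
Qed.

Lemma word_act_step w (v : V) (g : G) (i : nat) :
  greduced e (map fst w) -> size w <= r -> i < size w ->
  nth (v, 0%R) w i = (v, g) -> g != 0%R ->
  word_act w v g (word_state w i) = word_state w i.+1.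
Proof.
move=> wred wr iw wi g0.
have slot : word_slot w v (word_state w i) = Some (Ordinal iw).
  rewrite /word_slot; case: pickP => [j /andP[/eqP wj /forallP h] | /(_ (Ordinal iw))].
    congr Some; apply/val_inj/eqP => /=; apply/negPn/negP => ne_ji.
    have wi1 : (nth (v, 0%R) w i).1 = v by rewrite wi.
    have h' u : u != v -> ~~ e v u -> word_state w i u == word_state w j u.
      by move=> uv evu; have := h u; rewrite uv evu.
    move: ne_ji; rewrite neq_ltn => /orP [ji | ij].
      have [u [uv evu]] := context_inj wred wr ji iw wj wi1.
      by rewrite eq_sym h'.
    have [u [uv evu]] := context_inj wred wr ij (ltn_ord j) wi1 wj.
    by rewrite h'.
  by rewrite wi eqxx /= => /negP [] ; apply/forallP => u; rewrite eqxx !implybT.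
have occSv := occurrencesS (v, 0%R) v iw; rewrite wi /= eqxx addn1 in occSv.
apply/ffunP => u; have [->|uv] := eqVneq u v; last first.
  by rewrite word_act_neq // !ffunE (occurrencesS (v, 0%R)) // wi eq_sym (negbTE uv) addn0.
rewrite word_act_id /twist slot /= wi /= !ffunE occSv.
set a := inord _; set b := inord _.
have ab : a != b.
  rewrite -(inj_eq val_inj) /= /b -occSv !inordK ?occurrences_bound //.
  by rewrite occSv neq_ltn ltnSn.
(* The inner twist fixes [(0, a)] because [g != 0] and [a != b]; the shift gives [(g, a)], which the
   outer twist sends to [(0, b)]. *)
rewrite (@tpermD _ _ _ (0%R, a)) ?xpair_eqE ?(negbTE g0) ?(eq_sym b) ?(negbTE ab) ?andbF //.
by rewrite /shift /= add0r tpermL.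
Qed.

Local Notation wpoint := ((r.-bseq (V * G)) * state)%type.

(** All words of length at most [r] act side by side on one finite set; the word carried by a point
    never changes. *)
Definition point_act (v : V) (g : G) (x : wpoint) : wpoint :=
  (x.1, word_act x.1 v g x.2).

Lemma point_act_inj v g : injective (point_act v g).
Proof.
apply: (can_inj (g := point_act v (- g)%R)) => -[w f].
by rewrite /point_act /= word_actD subrr word_act0.
Qed.

Definition point_perm (v : V) (g : G) : {perm wpoint} := perm (@point_act_inj v g).

Lemma point_permD v g h : (point_perm v g * point_perm v h = point_perm v (g + h)%R)%g.
Proof. by apply/permP => -[w f]; rewrite permM !permE /point_act /= word_actD. Qed.

Lemma point_perm0 v : point_perm v 0%R = 1%g.
Proof. by apply/permP => -[w f]; rewrite permE perm1 /point_act /= word_act0. Qed.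

Lemma point_permC u v g h : e u v ->
  (point_perm u g * point_perm v h = point_perm v h * point_perm u g)%g.
Proof.
by move=> uv; apply/permP => -[w f]; rewrite !permM !permE /point_act /= word_actC // e_sym.
Qed.

Definition word_perm (w : word) : {perm wpoint} :=
  foldr (fun a s => point_perm a.1 a.2 * s)%g 1%g w.

(** On the point that carries [w] and its initial state, the permutation reads [w] letter by letter,
    and the count of the first vertex ends up positive. *)
Lemma word_perm_neq1 w : greduced e (map fst w) -> all (fun a => a.2 != 0%R) w ->
  0 < size w -> size w <= r -> word_perm w != 1%g.
Proof.
move=> wred w0 sw wr; pose b : r.-bseq (V * G) := Bseq wr.
(* Products of permutations act from left to right, so the letters of [w] act in reading order. *)
have walk w1 w2 : w = w1 ++ w2 ->
    word_perm w2 (b, word_state w (size w1)) = (b, word_state w (size w)).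
  elim: w2 w1 => [|[v g] w2 IH] w1 def_w.
    by rewrite /= perm1; congr (_, word_state _ _); rewrite def_w cats0.
  rewrite /= permM permE /point_act /=.
  have nth_w : nth (v, 0%R) w (size w1) = (v, g) by rewrite def_w nth_cat ltnn subnn.
  rewrite (@word_act_step w v g) //; first last.
  - by move: w0; rewrite def_w all_cat => /= /and3P [].
  - by rewrite def_w size_cat /= addnS ltnS leq_addr.
  by have := IH (rcons w1 (v, g)); rewrite size_rcons cat_rcons; apply.
apply/negP => /eqP w1; have := walk [::] w erefl; rewrite w1 perm1 => -[] /eqP.
case def_w : w sw => [|[v g] w'] // _; rewrite -def_w => /eqP/ffunP /(_ v) /eqP.
have -> x y : (word_state w x v == word_state w y v) = (occurrences w x v == occurrences w y v).
  exact: word_state_eq.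
rewrite ltn_eqF //.
have -> : v = (nth (v, g) w 0).1 by rewrite def_w.
by rewrite occurrences_lt // def_w.
Qed.
End WordAction.

(** * Labels, relabelling and closed walks *)

Fixpoint relabel_walk (V : finType) (n : V -> nat) (T : Type) (lab : forall v, T -> 'I_(n v))
    (rl : forall v, T -> 'I_(n v) -> T) (s : seq V) (p q : T) : Prop :=
  if s is v :: s' then
    exists2 x : 'I_(n v), x != lab v p & relabel_walk lab rl s' (rl v p x) q
  else p = q.

(* [wm_rl v p x] is the point obtained from [p] by changing its label at [v]
   into [x]. *)
Record walk_model (V : finType) (e : rel V) (n : V -> nat) (r : nat) := WalkModel {
  wm_size : nat;
  wm_lab : forall v, 'I_wm_size -> 'I_(n v);
  wm_rl : forall v, 'I_wm_size -> 'I_(n v) -> 'I_wm_size;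
  wm_size_gt0 : 0 < wm_size;
  wm_lab_rl : forall v p x, wm_lab v (wm_rl p x) = x;
  wm_rl_rl : forall v p (x y : 'I_(n v)), wm_rl (wm_rl p x) y = wm_rl p y;
  wm_rl_lab : forall v p, wm_rl p (wm_lab v p) = p;
  wm_lab_adj : forall u v p (x : 'I_(n v)), e v u -> wm_lab u (wm_rl p x) = wm_lab u p;
  wm_rl_adj : forall u v p (x : 'I_(n v)) (y : 'I_(n u)), e v u ->
    wm_rl (wm_rl p x) y = wm_rl (wm_rl p y) x;
  wm_no_loop : forall s p, greduced e s -> 0 < size s -> size s <= r ->
    ~ relabel_walk wm_lab wm_rl s p p
}.

Arguments wm_lab {V e n r} w v p : rename.
Arguments wm_rl {V e n r} w v p x : rename.

(** Division by [n] with remainder: the label is the remainder, and relabelling keeps the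
    quotient. *)
Lemma relabelling (N n : nat) : 0 < n -> n %| N.+1 ->
  exists (lab : 'I_N.+1 -> 'I_n) (rl : 'I_N.+1 -> 'I_n -> 'I_N.+1),
  [/\ forall g x, lab (rl g x) = x, forall g x y, rl (rl g x) y = rl g y
    & forall g, rl g (lab g) = g].
Proof.
move=> n0 /dvdnP [q Nq].
have lab_lt (g : 'I_N.+1) : g %% n < n by rewrite ltn_mod.
have rl_lt (g : 'I_N.+1) (x : 'I_n) : g %/ n * n + x < N.+1.
  have : g %/ n < q by rewrite ltn_divLR // -Nq.
  rewrite -(leq_pmul2r n0) -Nq mulSn; apply: leq_trans.
  by rewrite addnC ltn_add2r.
exists (fun g => Ordinal (lab_lt g)), (fun g x => Ordinal (rl_lt g x)).
split=> [g x|g x y|g]; apply/val_inj => /=.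
- by rewrite modnMDl modn_small.
- by rewrite divnMDl // (divn_small (ltn_ord x)) addn0.
- by rewrite -divn_eq.
Qed.

Section WalkModelExists.
Variables (V : finType) (e : rel V) (n : V -> nat) (r : nat).
Hypotheses (e_sym : symmetric e) (e_irr : irreflexive e).
Hypothesis n_gt0 : forall v, 0 < n v.

Lemma walk_model_exists : exists _ : walk_model e n r, True.
Proof.
(* The product makes every [n v] divide the order [N.+1]; the successor form gives ['I_N.+1] its
   additive group structure. *)
pose N := (\prod_v n v).-1.
have NE : N.+1 = \prod_v n v by rewrite /N prednK // prodn_gt0.
have rlP v : exists lr : ('I_N.+1 -> 'I_(n v)) * ('I_N.+1 -> 'I_(n v) -> 'I_N.+1),
  [/\ forall g x, lr.1 (lr.2 g x) = x, forall g x y, lr.2 (lr.2 g x) y = lr.2 g y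
    & forall g, lr.2 g (lr.1 g) = g].
  have [|lab [rl h]] := @relabelling N (n v) (n_gt0 v).
    by rewrite NE (bigD1 v) //= dvdn_mulr.
  by exists (lab, rl).
pose L v := (projT1 (cid (rlP v))).1; pose B v := (projT1 (cid (rlP v))).2.
have LB v g x : L v (B v g x) = x by rewrite /L /B; case: cid => lr [].
have BB v g x y : B v (B v g x) y = B v g y by rewrite /L /B; case: cid => lr [].
have BL v g : B v g (L v g) = g by rewrite /L /B; case: cid => lr [].
pose P := point_perm e r.
(* Points are elements of the permutation group, together with their exponents:
   moving by [g] at [v] multiplies the group element by [P v g] and adds [g] to
   the exponent of [v]. *)
pose T := ({perm ((r.-bseq (V * 'I_N.+1)) * {ffun V -> 'I_N.+1 * 'I_r.+1})} *
           {ffun V -> 'I_N.+1})%type.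
pose mv v g (p : T) : T :=
  ((p.1 * P N v g)%g, [ffun u => if u == v then p.2 u + g else p.2 u]%R).
(* The move at [v] that carries the present exponent to the element with label [x] and the same
   quotient. *)
pose rl v (p : T) x := mv v (B v (p.2 v) x - p.2 v)%R p.
have rlv v p x : (rl v p x).2 v = B v (p.2 v) x by rewrite /rl /= ffunE eqxx addrC subrK.
have rlu u v p x : u != v -> (rl v p x).2 u = p.2 u by rewrite /rl /= ffunE => /negbTE ->.
have mvD v g h p : mv v h (mv v g p) = mv v (g + h)%R p.
  congr pair; first by rewrite /= -mulgA /P point_permD.
  by apply/ffunP => u; rewrite !ffunE; case: eqP => // _; rewrite addrA.
have mvC u v g h p : e u v -> mv v h (mv u g p) = mv u g (mv v h p).
  move=> uv; congr pair; first by rewrite /= -!mulgA /P point_permC.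
  apply/ffunP => x; rewrite !ffunE; case: eqP => [->|] //.
  by case: eqP => // vu; rewrite vu e_irr in uv.
have neq u v : e u v -> u != v by move=> uv; apply: contraTneq uv => ->; rewrite e_irr.
pose lab v (p : 'I_#|{: T}|) := L v ((enum_val p).2 v).
pose rlr v (p : 'I_#|{: T}|) x := enum_rank (rl v (enum_val p) x).
unshelve eexists; last by [].
apply: (@WalkModel _ _ _ _ _ lab rlr); rewrite /lab /rlr.
- by apply/card_gt0P; exists (1%g, [ffun=> 0%R]).
- by move=> v p x; rewrite enum_rankK rlv.
- by move=> v p x y; rewrite enum_rankK /rl mvD -/(rl v _ x) rlv BB [in LHS]addrC addrA subrK.
- move=> v p; rewrite /rl BL subrr.
  rewrite -[RHS]enum_valK; congr enum_rank; case: (enum_val p) => s f.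
  congr pair; first by rewrite /P point_perm0 mulg1.
  by apply/ffunP => u; rewrite !ffunE addr0 if_same.
- by move=> u v p x /neq; rewrite eq_sym enum_rankK => /rlu ->.
- move=> u v p x y vu; have uv := neq _ _ vu; rewrite !enum_rankK.
  rewrite {1}/rl rlu; last by rewrite eq_sym.
  by rewrite mvC // -/(rl u _ y) /rl rlu.
move=> s p sred s0 sr.
rewrite -/lab -/rlr.
(* A change of label moves by a nonzero exponent, so a walk multiplies the group component by a word
   of nonzero letters; a closed walk would make that word trivial. *)
have walk t a b : relabel_walk lab rlr t a b ->
  exists w : seq (V * 'I_N.+1), [/\ map fst w = t, all (fun c => c.2 != 0%R) w
    & (enum_val b).1 = ((enum_val a).1 * word_perm e r w)%g].
  elim: t a => [|v t IH] a /=; first by move=> ->; exists [::]; rewrite mulg1.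
  move=> [x xa /IH [w [<- w0 ->]]].
  exists ((v, B v ((enum_val a).2 v) x - (enum_val a).2 v)%R :: w); split=> //=.
    rewrite w0 andbT subr_eq0; apply: contraNneq xa => eqB.
    by rewrite -(LB v ((enum_val a).2 v) x) eqB.
  by rewrite /rlr enum_rankK mulgA.
move=> /walk [w [def_s w0 /esym]]; rewrite -{2}[_.1]mulg1 => /mulgI /eqP.
apply/negP; apply: word_perm_neq1 => //; first by rewrite def_s.
  by rewrite -(size_map fst) def_s.
by rewrite -(size_map fst) def_s.
Qed.
End WalkModelExists.

Local Open Scope classical_set_scope.
Local Open Scope ring_scope.
Local Open Scope sesquilinear_scope.
Local Open Scope complex_scope.

(** * Matrix norms and dilations *)

Section SquareModulus.
Variable R : realType.
Implicit Types z w : R[i].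

Definition sqmod z : R := complex.Re z ^+ 2 + complex.Im z ^+ 2.

Lemma sqmod_ge0 z : 0 <= sqmod z.
Proof. by rewrite addr_ge0 // sqr_ge0. Qed.

Lemma sqmod0 : sqmod 0 = 0.
Proof. by rewrite /sqmod /= expr0n addr0. Qed.

Lemma sqmodM z w : sqmod (z * w) = sqmod z * sqmod w.
Proof. by case: z w => [a b] [c d]; rewrite /sqmod /=; ring. Qed.

Lemma sqmod_conj z : sqmod (Num.conj z) = sqmod z.
Proof. by case: z => [a b]; rewrite /sqmod /= sqrrN. Qed.

Lemma sqmod_distC z w : sqmod (z - w) = sqmod (w - z).
Proof. by case: z w => [a b] [c d]; rewrite /sqmod /=; ring. Qed.

Lemma Re_mul_conj z : complex.Re (Num.conj z * z) = sqmod z.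
Proof. by case: z => [a b]; rewrite /sqmod /=; ring. Qed.

Lemma sqmodD z w : sqmod (z + w) <= 2 * sqmod z + 2 * sqmod w.
Proof.
case: z w => [a b] [c d]; rewrite /sqmod /=; rewrite -subr_ge0.
have -> : 2 * (a ^+ 2 + b ^+ 2) + 2 * (c ^+ 2 + d ^+ 2) - ((a + c) ^+ 2 + (b + d) ^+ 2)
  = (a - c) ^+ 2 + (b - d) ^+ 2 by ring.
by rewrite addr_ge0 // sqr_ge0.
Qed.

Lemma sqmod_nat (n : nat) : sqmod n%:R = n%:R ^+ 2.
Proof.
have -> : (n%:R : R[i]) = (n%:R)%:C by rewrite rmorph_nat.
by rewrite /sqmod /= expr0n addr0.
Qed.

Lemma Re_sum (I : Type) (r : seq I) (P : pred I) (F : I -> R[i]) :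
  complex.Re (\sum_(i <- r | P i) F i) = \sum_(i <- r | P i) complex.Re (F i).
Proof. exact: raddf_sum. Qed.

Lemma Im_sum (I : Type) (r : seq I) (P : pred I) (F : I -> R[i]) :
  complex.Im (\sum_(i <- r | P i) F i) = \sum_(i <- r | P i) complex.Im (F i).
Proof. exact: raddf_sum. Qed.

(* Cauchy-Schwarz from Lagrange's identity: the summands below add up to twice
   the difference of the two sides. *)
Lemma sqmod_sum_mul (I : finType) (a b : I -> R[i]) :
  sqmod (\sum_i a i * b i) <= (\sum_i sqmod (a i)) * (\sum_i sqmod (b i)).
Proof.
pose d i j := sqmod (a i * (b j)^* - a j * (b i)^*).
have ge0 : 0 <= \sum_i \sum_j d i j.
  by apply: sumr_ge0 => i _; apply: sumr_ge0 => j _; exact: sqmod_ge0.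
have [sa saE] : exists f : I -> R, forall i, sqmod (a i) = f i by eexists.
have [sb sbE] : exists f : I -> R, forall i, sqmod (b i) = f i by eexists.
have [re reE] : exists f : I -> R, forall i, complex.Re (a i * b i) = f i by eexists.
have [im imE] : exists f : I -> R, forall i, complex.Im (a i * b i) = f i by eexists.
have dE i j : d i j = sa i * sb j + sb i * sa j
                   + (- 2 * re i) * re j + (- 2 * im i) * im j.
  rewrite -!saE -!sbE -!reE -!imE /d.
  by case: (a i) (b i) (a j) (b j) => [? ?] [? ?] [? ?] [? ?]; rewrite /sqmod /=; ring.
have sum2 (f g : I -> R) : \sum_i \sum_j f i * g j = (\sum_i f i) * (\sum_j g j).
  by rewrite mulr_suml; apply: eq_bigr => i _; rewrite mulr_sumr.
have -> : sqmod (\sum_i a i * b i) = (\sum_i re i) ^+ 2 + (\sum_i im i) ^+ 2.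
  by rewrite /sqmod Re_sum Im_sum; congr (_ ^+ 2 + _ ^+ 2); apply: eq_bigr.
have -> : \sum_i sqmod (a i) = \sum_i sa i by apply: eq_bigr.
have -> : \sum_i sqmod (b i) = \sum_i sb i by apply: eq_bigr.
move: ge0; under eq_bigr => i _ do (under eq_bigr => j _ do rewrite dE).
under eq_bigr => i _ do rewrite !big_split /=.
rewrite !big_split /= !sum2 -!mulr_sumr.
by move=> h; nra.
Qed.
End SquareModulus.

Section Frobenius.
Variable R : realType.
Local Notation C := R[i].

Lemma mxadjM m n p (A : 'M[C]_(m, n)) (B : 'M[C]_(n, p)) :
  (A *m B) ^t* = B ^t* *m A ^t*.
Proof. by rewrite trmx_mul map_mxM. Qed.

(** The squared Frobenius norm. Squares avoid roots; the price is the factor 2 in the triangle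
    inequalities. *)
Definition frob (m n : nat) (A : 'M[C]_(m, n)) : R := \sum_i \sum_j sqmod (A i j).

Lemma frob_ge0 m n (A : 'M[C]_(m, n)) : 0 <= frob A.
Proof. by apply: sumr_ge0 => i _; apply: sumr_ge0 => j _; exact: sqmod_ge0. Qed.

Lemma frob0 m n : frob (0 : 'M[C]_(m, n)) = 0.
Proof. by apply: big1 => i _; apply: big1 => j _; rewrite mxE sqmod0. Qed.

Lemma frobD m n (A B : 'M[C]_(m, n)) : frob (A + B) <= 2 * frob A + 2 * frob B.
Proof.
rewrite /frob !mulr_sumr -big_split /=; apply: ler_sum => i _.
rewrite !mulr_sumr -big_split /=; apply: ler_sum => j _.
by rewrite mxE sqmodD.
Qed.

Lemma frobZ m n c (A : 'M[C]_(m, n)) : frob (c *: A) = sqmod c * frob A.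
Proof.
rewrite /frob mulr_sumr; apply: eq_bigr => i _; rewrite mulr_sumr.
by apply: eq_bigr => j _; rewrite mxE sqmodM.
Qed.

Lemma frob_adj m n (A : 'M[C]_(m, n)) : frob (A ^t*) = frob A.
Proof.
rewrite /frob exchange_big; apply: eq_bigr => i _; apply: eq_bigr => j _.
by rewrite !mxE sqmod_conj.
Qed.

Lemma frob_col m n (A : 'M[C]_(m, n)) : frob A = \sum_j frob (col j A).
Proof.
rewrite /frob exchange_big; apply: eq_bigr => j _; apply: eq_bigr => i _.
by rewrite big_ord1 mxE.
Qed.

Lemma frob_mul m n p (A : 'M[C]_(m, n)) (B : 'M[C]_(n, p)) :
  frob (A *m B) <= frob A * frob B.
Proof.
rewrite /frob mulr_suml; apply: ler_sum => i _.
rewrite (exchange_big _ _ _ _ _ (fun k j => sqmod (B k j))) /= mulr_sumr.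
by apply: ler_sum => j _; rewrite mxE sqmod_sum_mul.
Qed.

Lemma frob_dot m (v : 'cV[C]_m) : complex.Re ((v ^t* *m v) 0 0) = frob v.
Proof.
rewrite mxE Re_sum; apply: eq_bigr => i _.
by rewrite big_ord1 !mxE Re_mul_conj.
Qed.

Lemma frob_dot_Im m (v : 'cV[C]_m) : complex.Im ((v ^t* *m v) 0 0) = 0.
Proof.
rewrite mxE Im_sum; apply: big1 => i _; rewrite !mxE.
by case: (v i 0) => a b /=; ring.
Qed.

Lemma norm2E n (A : 'M[C]_n) : norm2 A = Num.sqrt (frob A / n%:R).
Proof.
rewrite /norm2 /ntr; congr Num.sqrt.
have -> : frob A = complex.Re (\tr (A ^t* *m A)).
  rewrite /frob exchange_big Re_sum; apply: eq_bigr => i _ /=.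
  by rewrite mxE Re_sum; apply: eq_bigr => j _; rewrite !mxE Re_mul_conj.
have -> : (n%:R : C)^-1 = ((n%:R)^-1)%:C by rewrite fmorphV rmorph_nat.
by case: (\tr _) => a b /=; rewrite mulr0 subr0.
Qed.

Lemma euclidean_normE n (v : 'cV[C]_n) : euclidean_norm v = Num.sqrt (frob v).
Proof. by rewrite /euclidean_norm frob_dot. Qed.

(* [K] bounds the square of the operator norm. *)
Definition opbound (m n : nat) (K : R) (A : 'M[C]_(m, n)) : Prop :=
  0 <= K /\ forall v : 'cV_n, frob (A *m v) <= K * frob v.

Lemma opbound_mul m n p K (A : 'M[C]_(m, n)) (B : 'M[C]_(n, p)) :
  opbound K A -> frob (A *m B) <= K * frob B.
Proof.
move=> [K0 AK]; rewrite !frob_col mulr_sumr; apply: ler_sum => j _.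
by rewrite !colE -mulmxA -colE AK.
Qed.

(** With [w = A ^t* *m v], the square of [frob w] is the squared modulus of the inner product of
    [A *m w] and [v]. Cauchy-Schwarz bounds it by [K * frob w * frob v], and a factor [frob w]
    cancels. *)
Lemma opbound_adj m n K (A : 'M[C]_(m, n)) : opbound K A -> opbound K (A ^t*).
Proof.
move=> [K0 AK]; split=> // v; set w := _ *m v.
have [w0|w0] := eqVneq (frob w) 0.
  by rewrite w0 mulr_ge0 // frob_ge0.
have wgt0 : 0 < frob w by rewrite lt_neqAle eq_sym w0 frob_ge0.
rewrite -(ler_pM2l wgt0).
have -> : frob w * frob w = sqmod ((w ^t* *m w) 0 0).
  have := frob_dot w; rewrite /sqmod => ->.
  by rewrite frob_dot_Im expr0n addr0 expr2.
have -> : w ^t* *m w = (A *m w) ^t* *m v.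
  by rewrite mxadjM -mulmxA.
rewrite mxE; apply: le_trans (sqmod_sum_mul _ _) _.
have -> : \sum_i sqmod (v i 0) = frob v by apply: eq_bigr => i _; rewrite big_ord1.
have -> : \sum_i sqmod ((A *m w) ^t* 0 i) = frob (A *m w).
  by rewrite -frob_adj /frob big_ord1.
by rewrite mulrA ler_wpM2r ?frob_ge0 // mulrC AK.
Qed.

Lemma opbound_mulr m n p K (A : 'M[C]_(n, p)) (B : 'M[C]_(m, n)) :
  opbound K A -> frob (B *m A) <= K * frob B.
Proof.
move=> /opbound_adj AK; rewrite -frob_adj mxadjM -(frob_adj B).
exact: opbound_mul.
Qed.

Lemma opbound1 n : opbound 1 (1%:M : 'M[C]_n).
Proof. by split=> // v; rewrite mul1mx mul1r. Qed.

Lemma opboundM m n p K L (A : 'M[C]_(m, n)) (B : 'M[C]_(n, p)) :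
  opbound K A -> opbound L B -> opbound (K * L) (A *m B).
Proof.
move=> [K0 AK] [L0 BL]; split=> [|v]; first exact: mulr_ge0.
by rewrite -mulmxA -mulrA (le_trans (AK _)) // ler_wpM2l.
Qed.

Lemma opboundD m n K L (A B : 'M[C]_(m, n)) :
  opbound K A -> opbound L B -> opbound (2 * K + 2 * L) (A + B).
Proof.
move=> [K0 AK] [L0 BL]; split=> [|v]; first lra.
rewrite mulmxDl (le_trans (frobD _ _)) // [leRHS]mulrDl -!mulrA.
by rewrite lerD // ler_wpM2l.
Qed.

Lemma opboundZ m n K c (A : 'M[C]_(m, n)) :
  opbound K A -> opbound (sqmod c * K) (c *: A).
Proof.
move=> [K0 AK]; split=> [|v]; first by rewrite mulr_ge0 // sqmod_ge0.
by rewrite -scalemxAl frobZ -mulrA ler_wpM2l // sqmod_ge0.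
Qed.

Lemma opbound_entry m n K (A : 'M[C]_(m, n)) i j : opbound K A -> sqmod (A i j) <= K.
Proof.
move=> [K0 AK]; have := AK (delta_mx j 0).
have -> : frob (delta_mx j 0 : 'cV[C]_n) = 1.
  rewrite /frob (bigD1 j) //= big_ord1 mxE !eqxx /= big1 ?addr0.
    by rewrite /sqmod /= expr1n expr0n addr0.
  by move=> k kj; rewrite big_ord1 mxE (negbTE kj) sqmod0.
rewrite mulr1 -colE; apply: le_trans.
rewrite /frob (bigD1 i) //= big_ord1 mxE lerDl.
by apply: sumr_ge0 => k _; apply: sumr_ge0 => l _; exact: sqmod_ge0.
Qed.

Lemma diag_partE n (A : 'M[C]_n) i j : diag_part A i j = if i == j then A i i else 0.
Proof. by rewrite !mxE; case: eqP => [->|]; rewrite ?mulr1n ?mulr0n. Qed.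

Lemma opbound_diag n K (A : 'M[C]_n) : opbound K A -> opbound K (diag_part A).
Proof.
move=> AK; split=> [|v]; first by case: AK.
rewrite /frob mulr_sumr; apply: ler_sum => i _; rewrite !big_ord1.
by rewrite /diag_part mul_diag_mx !mxE sqmodM ler_wpM2r ?sqmod_ge0 // (opbound_entry i i AK).
Qed.

Lemma opbound_opnorm n K (A : 'M[C]_n) : 0 <= K -> (mx_opnorm A <= K) <-> opbound (K ^+ 2) A.
Proof.
move=> K0; pose S := [set euclidean_norm (A *m v) | v in [set v | euclidean_norm v <= 1]].
have S0 : S !=set0.
  exists (euclidean_norm (A *m 0)); exists 0 => //=.
  by rewrite euclidean_normE frob0 sqrtr0.
split=> [AK|[_ AK]]; last first.
  rewrite /mx_opnorm; apply: sup_le_ub => // _ [v /= v1 <-].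
  rewrite !euclidean_normE in v1 *.
  have -> : K = Num.sqrt (K ^+ 2) by rewrite sqrtr_sqr ger0_norm.
  rewrite ler_sqrt ?sqr_ge0 // (le_trans (AK v)) // ler_piMr ?sqr_ge0 //.
  by move: v1; rewrite -[leRHS]sqrtr1 ler_sqrt.
split=> [|v]; first exact: sqr_ge0.
have [v0|v0] := eqVneq (frob v) 0.
  rewrite v0 mulr0; apply: le_trans (frob_mul _ _) _.
  by rewrite v0 mulr0.
have vgt0 : 0 < frob v by rewrite lt_neqAle eq_sym v0 frob_ge0.
pose c : R := (Num.sqrt (frob v))^-1.
have c2 : sqmod c%:C = (frob v)^-1.
  by rewrite /sqmod /= expr0n addr0 exprVn sqr_sqrtr // ltW.
have Sv : S (euclidean_norm (A *m (c%:C *: v))).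
  exists (c%:C *: v) => //=; rewrite euclidean_normE frobZ c2 mulVf //.
  by rewrite sqrtr1.
(* A supremum is informative only for a set bounded above; the Frobenius norm of [A] bounds this
   one. *)
have ubS : has_ubound S.
  exists (Num.sqrt (frob A)) => _ [u /= u1 <-].
  move: u1; rewrite !euclidean_normE -[X in _ <= X]sqrtr1 ler_sqrt // => u1.
  rewrite ler_sqrt ?frob_ge0 // (le_trans (frob_mul _ _)) //.
  by rewrite ler_piMr // frob_ge0.
have : euclidean_norm (A *m (c%:C *: v)) <= K.
  exact: le_trans (ub_le_sup ubS Sv) AK.
rewrite euclidean_normE -scalemxAr frobZ c2 => h.
rewrite -ler_pdivrMr // mulrC.
rewrite -(sqr_sqrtr (a := (frob v)^-1 * frob (A *m v))).
  by rewrite ler_sqr ?nnegrE // sqrtr_ge0.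
by rewrite mulr_ge0 ?frob_ge0 // invr_ge0 ltW.
Qed.

(* The squared 2-norm of [diag_part A - c%:M]. *)
Definition diag_dist (n : nat) (A : 'M[C]_n) (c : C) : R :=
  (\sum_i sqmod (A i i - c)) / n%:R.

Lemma diag_dist_ge0 n (A : 'M[C]_n) c : 0 <= diag_dist A c.
Proof. by rewrite divr_ge0 ?ler0n // sumr_ge0 // => i _; exact: sqmod_ge0. Qed.

Lemma norm2_diag_part n (A : 'M[C]_n) c :
  norm2 (diag_part A - c%:M) = Num.sqrt (diag_dist A c).
Proof.
rewrite norm2E; congr (Num.sqrt (_ / _)); apply: eq_bigr => i _.
rewrite (bigD1 i) //= big1 ?addr0; last first.
  by move=> j ji; rewrite mxE diag_partE 2!mxE eq_sym (negbTE ji) mulr0n subrr sqmod0.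
by rewrite mxE diag_partE 2!mxE eqxx mulr1n.
Qed.

Lemma diag_dist_linear n (A B : 'M[C]_n) a c d :
  diag_dist (a *: A + B) (a * c + d) <= 2 * (sqmod a * diag_dist A c) + 2 * diag_dist B d.
Proof.
rewrite /diag_dist !mulrA -mulrDl ler_wpM2r ?invr_ge0 ?ler0n //.
rewrite !mulr_sumr -big_split /=; apply: ler_sum => i _.
rewrite !mxE -mulrA -sqmodM; apply: le_trans (sqmodD _ _).
by rewrite mulrBr opprD addrACA.
Qed.

Lemma diag_dist_center n (A : 'M[C]_n) c d : (0 < n)%N ->
  diag_dist A d <= 2 * diag_dist A c + 2 * sqmod (c - d).
Proof.
move=> n0; have n0' : 0 < n%:R :> R by rewrite ltr0n.
rewrite /diag_dist ler_pdivrMr // mulrDl mulrA divfK ?gt_eqF //.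
have -> : 2 * sqmod (c - d) * n%:R = \sum_(i < n) 2 * sqmod (c - d).
  by rewrite sumr_const card_ord mulr_natr.
rewrite mulr_sumr -big_split /=; apply: ler_sum => i _.
apply: le_trans (sqmodD _ _).
by rewrite addrA subrK.
Qed.

(** Cauchy-Schwarz for the diagonal of [A - c%:M] against the constant 1. *)
Lemma sqmod_ntr n (A : 'M[C]_n) c : (0 < n)%N -> sqmod (ntr A - c) <= diag_dist A c.
Proof.
move=> n0; have n0C : n%:R != 0 :> C by rewrite pnatr_eq0 -lt0n.
have n0' : 0 < n%:R :> R by rewrite ltr0n.
have eqn : (ntr A - c) * n%:R = \sum_i (A i i - c) * 1.
  under eq_bigr do rewrite mulr1.
  by rewrite sumrB sumr_const card_ord mulrBl /ntr divfK // mulr_natr.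
have := sqmod_sum_mul (fun i => A i i - c) (fun=> 1); rewrite -eqn sqmodM sqmod_nat.
have -> : \sum_(i < n) sqmod (1 : C) = n%:R.
  by rewrite sumr_const card_ord /sqmod /= expr0n addr0 expr1n.
by rewrite expr2 mulrA ler_pM2r // /diag_dist ler_pdivlMr.
Qed.

Lemma diag_dist_frob n (A : 'M[C]_n) : diag_dist A 0 <= frob A / n%:R.
Proof.
rewrite /diag_dist ler_wpM2r ?invr_ge0 ?ler0n //; apply: ler_sum => i _.
rewrite subr0 (bigD1 i) //= lerDl; apply: sumr_ge0 => j _; exact: sqmod_ge0.
Qed.

Lemma frob_diag_part n (A : 'M[C]_n) : frob (diag_part A) / n%:R = diag_dist A 0.
Proof.
congr (_ / _); apply: eq_bigr => i _; rewrite (bigD1 i) //= diag_partE eqxx subr0.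
by rewrite big1 ?addr0 // => j ji; rewrite diag_partE eq_sym (negbTE ji) sqmod0.
Qed.
End Frobenius.

(** * Dilation of matrices to a walk model *)

Section Dilation.
Variables (R : realType) (V : finType) (e : rel V) (n : V -> nat) (r : nat).
Variable w : walk_model e n r.
Local Notation C := R[i].
Local Notation m := (wm_size w).

(** The test says that [q] is a relabelling of [p] at [v]; each class of points so related carries
    one copy of [A]. *)
Definition dilate (v : V) (A : 'M[C]_(n v)) : 'M[C]_m :=
  \matrix_(p, q) if wm_rl w v p (wm_lab w v q) == q
                 then A (wm_lab w v p) (wm_lab w v q) else 0.

Lemma sum_relabel (T : zmodType) v (p : 'I_m) (F : 'I_(n v) -> 'I_m -> T) :
  \sum_(q | wm_rl w v p (wm_lab w v q) == q) F (wm_lab w v q) q = \sum_x F x (wm_rl w v p x).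
Proof.
rewrite (reindex (fun x : 'I_(n v) => wm_rl w v p x)) /=; last first.
  exists (fun q => wm_lab w v q) => [x _|q]; first exact: wm_lab_rl.
  by rewrite inE => /eqP.
by apply: eq_big => [x | x _]; rewrite wm_lab_rl ?eqxx.
Qed.

Lemma dilate_mulE v (A : 'M[C]_(n v)) k (B : 'M[C]_(m, k)) p q :
  (dilate A *m B) p q = \sum_x A (wm_lab w v p) x * B (wm_rl w v p x) q.
Proof.
rewrite mxE -(sum_relabel p (fun x t => A (wm_lab w v p) x * B t q)).
rewrite [RHS]big_mkcond /=; apply: eq_bigr => t _.
by rewrite mxE; case: ifP => // _; rewrite mul0r.
Qed.

Lemma relabel_sym v p q : (wm_rl w v p (wm_lab w v q) == q) = (wm_rl w v q (wm_lab w v p) == p).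
Proof.
by apply/eqP/eqP => <-; rewrite wm_rl_rl wm_rl_lab.
Qed.

Lemma dilateM v (A B : 'M[C]_(n v)) : dilate (A *m B) = dilate A *m dilate B.
Proof.
apply/matrixP => p q; rewrite dilate_mulE !mxE; case: ifP => pq.
  apply: eq_bigr => x _; rewrite mxE wm_lab_rl.
  by rewrite wm_rl_rl pq.
rewrite big1 // => x _; rewrite mxE wm_rl_rl pq mulr0 //.
Qed.

Lemma dilate1 v : dilate (1%:M : 'M[C]_(n v)) = 1%:M.
Proof.
apply/matrixP => p q; rewrite !mxE; have [<-|pq] := eqVneq p q.
  by rewrite wm_rl_lab !eqxx.
case: ifP => // rpq; case: eqVneq => // lpq.
by move: rpq pq; rewrite -lpq wm_rl_lab => ->.
Qed.

Lemma dilate_linear v a (A B : 'M[C]_(n v)) :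
  dilate (a *: A + B) = a *: dilate A + dilate B.
Proof.
by apply/matrixP => p q; rewrite !mxE; case: ifP => // _; rewrite mulr0 addr0.
Qed.

Lemma dilate_adj v (A : 'M[C]_(n v)) : dilate (A ^t*) = (dilate A) ^t*.
Proof.
by apply/matrixP => p q; rewrite !mxE relabel_sym; case: ifP => // _; rewrite rmorph0.
Qed.

(** Relabelling at one of two adjacent vertices keeps the label at the other and commutes with
    relabelling there, so both products are sums of the same terms. *)
Lemma dilateC u v (A : 'M[C]_(n u)) (B : 'M[C]_(n v)) : symmetric e -> e u v ->
  dilate A *m dilate B = dilate B *m dilate A.
Proof.
move=> e_sym uv; have vu : e v u by rewrite e_sym.
rewrite -[dilate B in LHS]mulmx1 -[dilate A in RHS]mulmx1.
apply/matrixP => p q; rewrite !dilate_mulE.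
under eq_bigr => x _ do rewrite dilate_mulE mulr_sumr.
under [RHS]eq_bigr => x _ do rewrite dilate_mulE mulr_sumr.
rewrite exchange_big; apply: eq_bigr => y _; apply: eq_bigr => x _.
by rewrite !wm_lab_adj // wm_rl_adj // !mulrA [_ * B _ _]mulrC.
Qed.

Lemma labels_gt0 v : (0 < n v)%N.
Proof. exact: leq_ltn_trans (ltn_ord (wm_lab w v (Ordinal (wm_size_gt0 w)))). Qed.

(** Double counting: each point arises by relabelling from exactly [n v] points. *)
Lemma sum_relabel_all v (F : 'I_m -> R) :
  \sum_p \sum_y F (wm_rl w v p y) = (n v)%:R * \sum_p F p.
Proof.
have cnt q : \sum_(p | wm_rl w v p (wm_lab w v q) == q) 1 = (n v)%:R :> R.
  under eq_bigl => p do rewrite relabel_sym.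
  by rewrite (sum_relabel q (fun _ _ => 1)) sumr_const card_ord.
under eq_bigr => p _ do rewrite -(sum_relabel p (fun _ q => F q)).
rewrite (exchange_big_dep xpredT) //= mulr_sumr; apply: eq_bigr => q _.
by rewrite -(cnt q) mulr_suml; apply: eq_bigr => p _; rewrite mul1r.
Qed.

(** The labels at [v] are equidistributed over the points, which is why dilation preserves
    normalized 2-norms. *)
Lemma sum_lab v (F : 'I_(n v) -> R) :
  (\sum_p F (wm_lab w v p)) / m%:R = (\sum_x F x) / (n v)%:R.
Proof.
have eqn : (\sum_p F (wm_lab w v p)) * (n v)%:R = (\sum_x F x) * m%:R.
  rewrite mulrC -sum_relabel_all.
  under eq_bigr => p _ do (under eq_bigr => x _ do rewrite wm_lab_rl).
  by rewrite sumr_const card_ord mulr_natr.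
have m0 : m%:R != 0 :> R by rewrite pnatr_eq0 -lt0n wm_size_gt0.
have n0 : (n v)%:R != 0 :> R by rewrite pnatr_eq0 -lt0n labels_gt0.
by apply/eqP; rewrite eqr_div // eqn.
Qed.

Lemma frob_dilate v (A : 'M[C]_(n v)) :
  frob (dilate A) / m%:R = frob A / (n v)%:R.
Proof.
rewrite [frob A]/frob -sum_lab; congr (_ / _); apply: eq_bigr => p _.
rewrite -(sum_relabel p (fun x _ => sqmod (A (wm_lab w v p) x))).
by rewrite [RHS]big_mkcond /=; apply: eq_bigr => q _; rewrite mxE; case: ifP; rewrite ?sqmod0.
Qed.

(** A vector splits into blocks over the relabelling classes, and the dilation acts on each block as
    [A]. Summing over all points counts every class [n v] times on both sides, hence the factor
    [n v] introduced below. *)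
Lemma opbound_dilate v K (A : 'M[C]_(n v)) : opbound K A -> opbound K (dilate A).
Proof.
move=> [K0 AK]; split=> // x.
have n0 : 0 < (n v)%:R :> R by rewrite ltr0n labels_gt0.
pose blk p : 'cV[C]_(n v) := \col_y x (wm_rl w v p y) 0.
rewrite -(ler_pM2l n0) mulrCA /frob -!(@sum_relabel_all v) mulr_sumr; apply: ler_sum => p _.
have -> : \sum_y \sum_j sqmod ((dilate A *m x) (wm_rl w v p y) j) = frob (A *m blk p).
  apply: eq_bigr => y _; apply: eq_bigr => j _; rewrite (ord1 j) dilate_mulE mxE.
  congr sqmod; apply: eq_bigr => z _; rewrite wm_lab_rl wm_rl_rl mxE //.
apply: le_trans (AK _) _; rewrite ler_wpM2l //; apply: ler_sum => y _.
by rewrite !big_ord1 mxE.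
Qed.

Definition dilate_prod (s : seq {v : V & 'M[C]_(n v)}) : 'M[C]_m :=
  foldr (fun a B => dilate (tagged a) *m B) 1%:M s.

(** A nonzero entry needs a path of nonzero coefficients, and zero diagonals force each step to
    change the label. *)
Lemma dilate_prod_walk (s : seq {v : V & 'M[C]_(n v)}) p q :
  (forall a, List.In a s -> forall x, tagged a x x = 0) -> dilate_prod s p q != 0 ->
  relabel_walk (wm_lab w) (wm_rl w) (map tag s) p q.
Proof.
elim: s p => [|a s IH] p /= s0.
  by rewrite mxE; case: (p =P q); rewrite ?eqxx.
rewrite dilate_mulE => nz.
have [x xnz] : exists x,
    tagged a (wm_lab w (tag a) p) x * dilate_prod s (wm_rl w (tag a) p x) q != 0.
  apply/existsP; apply: contraNT nz; rewrite negb_exists => /forallP h.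
  by rewrite big1 // => x _; apply/eqP; have := h x; rewrite negbK.
exists x; first by apply: contraNneq xnz => ->; rewrite s0 ?mul0r //; left.
apply: IH; first by move=> b bs; apply: s0; right.
by apply: contraNneq xnz => ->; rewrite mulr0.
Qed.

Lemma dilate_prod_diag0 (s : seq {v : V & 'M[C]_(n v)}) p :
  (forall a, List.In a s -> forall x, tagged a x x = 0) ->
  greduced e (map tag s) -> (0 < size s)%N -> (size s <= r)%N ->
  dilate_prod s p p = 0.
Proof.
move=> s0 sred sgt0 sr; apply/eqP/negPn/negP => /(dilate_prod_walk s0).
by apply: wm_no_loop; rewrite ?size_map.
Qed.
End Dilation.

(** * Noncommutative polynomials *)

Section NcPoly.
Variables (C : nzRingType) (I : Type).

Definition ncmul (P Q : ncpoly C I) : ncpoly C I :=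
  [seq (p.1 * q.1, p.2 ++ q.2) | p <- P, q <- Q].

Variables (A : lmodType C) (one : A) (mul : A -> A -> A) (star : A -> A).
Variables (x : I -> A) (S : set A).
Hypothesis mulA : associative mul.
Hypothesis mul1 : left_id one mul.
Hypothesis mul_linl : forall c a a' b, mul (c *: a + a') b = c *: mul a b + mul a' b.
Hypothesis mul_linr : forall c a b b', S a ->
  mul a (c *: b + b') = c *: mul a b + mul a b'.
Hypothesis S1 : S one.
Hypothesis SM : forall a b, S a -> S b -> S (mul a b).
Hypothesis Sx : forall i, S (x i).
Hypothesis Sx' : forall i, S (star (x i)).

Local Notation letter l := (if l.2 then star (x l.1) else x l.1).
Local Notation monomial s := (foldr mul one [seq letter l | l <- s]).
Local Notation eval := (ncpoly_eval one mul star x).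

Lemma ncpoly_eval_cons p P : eval (p :: P) = p.1 *: monomial p.2 + eval P.
Proof. by rewrite /ncpoly_eval big_cons. Qed.

Lemma ncpoly_eval_cat P Q : eval (P ++ Q) = eval P + eval Q.
Proof. by rewrite /ncpoly_eval big_cat. Qed.

Lemma monomial_mem s : S (monomial s).
Proof. by elim: s => [|[i []] s IH] //=; apply: SM. Qed.

Lemma monomial_cat s t : monomial (s ++ t) = mul (monomial s) (monomial t).
Proof. by elim: s => [|l s IH] /=; rewrite ?mul1 // IH mulA. Qed.

(** Operators are plain functions, and composition is linear in its second argument only behind a
    linear map; hence right linearity is assumed on [S], which contains all monomials. *)
Lemma ncpoly_eval_mul P Q : eval (ncmul P Q) = mul (eval P) (eval Q).
Proof.
have mul0 b : mul 0 b = 0.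
  by have := mul_linl 1 0 0 b; rewrite !scale1r addr0 => /esym/eqP; rewrite -subr_eq0 addrK => /eqP.
have mul_0 a : S a -> mul a 0 = 0.
  by move=> /(mul_linr 1 0 0); rewrite !scale1r addr0 => /esym/eqP; rewrite -subr_eq0 addrK => /eqP.
elim: P => [|p P IH]; first by rewrite /ncpoly_eval !big_nil mul0.
rewrite -[ncmul _ _]/([seq (p.1 * q.1, p.2 ++ q.2) | q <- Q] ++ ncmul P Q).
rewrite ncpoly_eval_cat IH ncpoly_eval_cons mul_linl.
congr (_ + _); elim: Q {IH} => [|q Q IH].
  by rewrite /ncpoly_eval !big_nil mul_0 ?scaler0 //; exact: monomial_mem.
rewrite /= !ncpoly_eval_cons IH mul_linr ?scalerDr; last exact: monomial_mem.
by rewrite /= monomial_cat scalerA.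
Qed.
End NcPoly.

Section Operators.
Variables (R : realType) (M : tracialVN R).
Local Notation H := (tvn_space M).
Local Notation alg := (tvn_alg M).

Lemma tvn_linear (T : H -> H) : alg T -> linear T.
Proof. by move=> /(vna_bounded (tvn_algP M)) []. Qed.

Lemma tvn_comp_linear (a : R[i]) (S T U : H -> H) : alg S ->
  S \o (a *: T + U) = a *: (S \o T) + (S \o U).
Proof.
by move=> /tvn_linear S_lin; apply/funext => h; exact: (S_lin a (T h) (U h)).
Qed.

Lemma tvn_1 : alg idfun. Proof. exact: vna_one (tvn_algP M). Qed.

Lemma tvn_lin (a : R[i]) (S T : H -> H) : alg S -> alg T -> alg (a *: S + T).
Proof. exact: vna_linear (tvn_algP M) _ _ _. Qed.

Lemma tvn_0 : alg (0 : H -> H).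
Proof. by rewrite -(addNr (idfun : H -> H)) -scaleN1r; apply: tvn_lin; exact: tvn_1. Qed.

Lemma tvn_mul (S T : H -> H) : alg S -> alg T -> alg (S \o T).
Proof. exact: vna_mul (tvn_algP M) _ _. Qed.

Lemma tvn_adj (T : H -> H) : alg T -> alg (adjoint T).
Proof. exact: vna_adjoint (tvn_algP M) _. Qed.

Lemma tvn_trace_lin (a : R[i]) (S T : H -> H) : alg S -> alg T ->
  tvn_trace M (a *: S + T) = a * tvn_trace M S + tvn_trace M T.
Proof. exact: tr_linear (tvn_traceP M) _ _ _. Qed.

Lemma tvn_trace1 : tvn_trace M idfun = 1.
Proof. exact: tr_one (tvn_traceP M). Qed.

Lemma tvn_trace0 : tvn_trace M (0 : H -> H) = 0.
Proof.
have := tvn_trace_lin (-1) tvn_1 tvn_1.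
by rewrite scaleN1r addNr mulN1r addNr.
Qed.

Variables (I : Type) (x : I -> (H -> H)).
Hypothesis xM : forall i, alg (x i).

Definition op_letter (l : I * bool) : H -> H :=
  if l.2 then adjoint (x l.1) else x l.1.
Definition op_monomial (s : seq (I * bool)) : H -> H :=
  foldr (fun S T => S \o T) idfun (map op_letter s).

Lemma op_letter_mem l : alg (op_letter l).
Proof. by case: l => i [] /=; rewrite /op_letter /=; [apply: tvn_adj | ]. Qed.

Lemma op_monomial_mem s : alg (op_monomial s).
Proof. 
elim: s => [|l s IH]; first exact: tvn_1.
by apply: tvn_mul IH; exact: op_letter_mem.
Qed.

Lemma ncpoly_op_cons p P :
  ncpoly_op x (p :: P) = p.1 *: op_monomial p.2 + ncpoly_op x P.
Proof. exact: ncpoly_eval_cons. Qed.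

Lemma ncpoly_op_nil : ncpoly_op x [::] = 0.
Proof. by rewrite /ncpoly_op /ncpoly_eval big_nil. Qed.

Lemma ncpoly_op_mem P : alg (ncpoly_op x P).
Proof.
elim: P => [|p P IH]; first by rewrite ncpoly_op_nil; exact: tvn_0.
by rewrite ncpoly_op_cons; apply: tvn_lin => //; exact: op_monomial_mem.
Qed.

Lemma ncpoly_op_mul P Q : ncpoly_op x (ncmul P Q) = ncpoly_op x P \o ncpoly_op x Q.
Proof.
apply: (@ncpoly_eval_mul _ _ _ _ (fun S T => S \o T) _ _ alg) => //.
- by move=> c a b b'; exact: tvn_comp_linear.
- exact: tvn_1.
- exact: tvn_mul.
- by move=> i; exact: tvn_adj.
Qed.
End Operators.

Section Matrices.
Variables (R : realType) (n : nat) (I : Type) (X : I -> 'M[R[i]]_n).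
Implicit Types P Q : ncpoly R[i] I.

Definition mx_letter (l : I * bool) : 'M[R[i]]_n := if l.2 then X l.1 ^t* else X l.1.
Definition mx_monomial (s : seq (I * bool)) : 'M[R[i]]_n :=
  foldr (fun A B => A *m B) 1%:M (map mx_letter s).

Lemma ncpoly_mx_cons p P :
  ncpoly_mx X (p :: P) = p.1 *: mx_monomial p.2 + ncpoly_mx X P.
Proof. exact: ncpoly_eval_cons. Qed.

Lemma ncpoly_mx_nil : ncpoly_mx X [::] = 0.
Proof. by rewrite /ncpoly_mx /ncpoly_eval big_nil. Qed.

Lemma ncpoly_mx_mul P Q : ncpoly_mx X (ncmul P Q) = ncpoly_mx X P *m ncpoly_mx X Q.
Proof.
apply: (@ncpoly_eval_mul _ _ _ _ (fun A B => A *m B) _ _ setT) => //.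
- exact: mulmxA.
- exact: mul1mx.
- by move=> c a a' b; rewrite mulmxDl scalemxAl.
- by move=> c a b b' _; rewrite mulmxDr scalemxAr.
Qed.
End Matrices.

Lemma opbound_ncpoly (R : realType) (I : Type) (n : nat -> nat)
    (X : forall k, I -> 'M[R[i]]_(n k)) :
  (forall i, exists K, forall k, opbound K (X k i)) ->
  forall P, exists K, forall k, opbound K (ncpoly_mx (X k) P).
Proof.
move=> XK; elim=> [|[c s] P [L PL]].
  by exists 0 => k; rewrite ncpoly_mx_nil; split=> // v; rewrite mul0mx frob0 mul0r.
suff [K sK] : exists K, forall k, opbound K (mx_monomial (X k) s).
  exists (2 * (sqmod c * K) + 2 * L) => k; rewrite ncpoly_mx_cons.
  by apply: opboundD => //; exact: opboundZ.
elim: s => [|[i b] s [K sK]]; first by exists 1 => k; exact: opbound1.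
have [Ki iK] := XK i; exists (Ki * K) => k.
by apply: opboundM => //; case: b; [apply: opbound_adj; exact: iK | exact: iK].
Qed.

(** * Convergence of traces and diagonals *)

Section Convergence.
Variable R : realType.

Lemma squeeze0 (u v : nat -> R) : (\forall k \near \oo, 0 <= u k <= v k) ->
  v k @[k --> \oo] --> 0 -> u k @[k --> \oo] --> 0.
Proof. by move=> uv v0; apply: squeeze_cvgr (cvg_cst 0) v0. Qed.

Lemma cvg0_lin (u v : nat -> R) (a b : R) : u k @[k --> \oo] --> 0 ->
  v k @[k --> \oo] --> 0 -> a * u k + b * v k @[k --> \oo] --> 0.
Proof.
move=> u0 v0; have := cvgD (cvgM (cvg_cst a) u0) (cvgM (cvg_cst b) v0).
by rewrite !mulr0 addr0; exact.
Qed.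

Lemma cvg_sqrt0 (u : nat -> R) : (forall k, 0 <= u k) ->
  Num.sqrt (u k) @[k --> \oo] --> 0 <-> u k @[k --> \oo] --> 0.
Proof.
move=> u0; split=> [su0|su0].
  have -> : u = (fun k => Num.sqrt (u k) * Num.sqrt (u k)).
    by apply/funext => k; rewrite -expr2 sqr_sqrtr.
  by rewrite -[0 in X in _ --> X](mulr0 0); exact: (cvgM su0 su0).
rewrite -[0 in X in _ --> X](sqrtr0 R).
exact: (continuous_cvg _ (@sqrt_continuous R 0) su0).
Qed.

Lemma cvg_sqmod (u : nat -> R[i]) (c : R[i]) :
  u k @[k --> \oo] --> c <-> sqmod (u k - c) @[k --> \oo] --> 0.
Proof.
rewrite -cvg_sqrt0; last by move=> k; exact: sqmod_ge0.
have normE k : `|c - u k| = (Num.sqrt (sqmod (u k - c)))%:C.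
  by rewrite distrC normc_def.
split=> [/cvgrPdist_lt uc | /cvgrPdist_lt uc].
  apply/cvgrPdist_lt => eps eps0.
  have := uc eps%:C; rewrite ltcR => /(_ eps0); apply: filterS => k.
  by rewrite normE ltcR sub0r normrN ger0_norm // sqrtr_ge0.
(* Radii in [R[i]] are its positive elements, whose imaginary part is zero. *)
apply/cvgrPdist_lt => -[eps im]; rewrite ltcE /= => /andP[/eqP im0 eps0].
have := uc eps eps0; apply: filterS => k.
rewrite normE sub0r normrN ger0_norm ?sqrtr_ge0 // => h.
by rewrite ltcE /= -im0 eqxx.
Qed.

(** Merges convergence of the trace and asymptotic constancy on the diagonal, by [diag_cvgP], into
    one condition that is linear and can be carried along words. *)
Definition diag_cvg (m : nat -> nat) (A : forall k, 'M[R[i]]_(m k)) (c : R[i]) : Prop :=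
  diag_dist (A k) c @[k --> \oo] --> 0.

Lemma diag_cvg_linear m (A B : forall k, 'M[R[i]]_(m k)) a c d :
  diag_cvg A c -> diag_cvg B d -> diag_cvg (fun k => a *: A k + B k) (a * c + d).
Proof.
move=> Ac Bd; apply: squeeze0 (cvg0_lin (2 * sqmod a) 2 Ac Bd); apply: nearW => k.
by rewrite diag_dist_ge0 -mulrA diag_dist_linear.
Qed.

Lemma diag_cvgP m (A : forall k, 'M[R[i]]_(m k)) c : (forall k, (0 < m k)%N) ->
  diag_cvg A c <->
  ntr (A k) @[k --> \oo] --> c /\ asymptotically_constant_on_diagonal A.
Proof.
move=> m0; rewrite cvg_sqmod /asymptotically_constant_on_diagonal.
have -> : (fun k => norm2 (diag_part (A k) - (ntr (A k))%:M)) =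
          (fun k => Num.sqrt (diag_dist (A k) (ntr (A k)))).
  by apply/funext => k; rewrite norm2_diag_part.
rewrite cvg_sqrt0; last by move=> k; exact: diag_dist_ge0.
have tr_cvg : diag_cvg A c -> sqmod (ntr (A k) - c) @[k --> \oo] --> 0.
  by apply: squeeze0; apply: nearW => k; rewrite sqmod_ge0 sqmod_ntr.
split=> [Ac | [trA A0]].
  split; first exact: tr_cvg.
  apply: squeeze0 (cvg0_lin 2 2 Ac (tr_cvg Ac)); apply: nearW => k.
  rewrite diag_dist_ge0 (le_trans (diag_dist_center _ c _ _)) //.
  by rewrite sqmod_distC.
apply: squeeze0 (cvg0_lin 2 2 A0 trA); apply: nearW => k.
by rewrite diag_dist_ge0 diag_dist_center.
Qed.
End Convergence.

(** * Convergence along words *)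

Section WordInduction.
Variables (V : finType) (e : rel V) (A : V -> Type).
Local Notation sym := {v : V & A v}.
Variables (centered : forall v, A v -> Prop) (D : seq sym -> Prop).

Hypothesis D_center : forall s1 v (a : A v) s2, exists2 b : A v, centered b &
  D (s1 ++ existT _ v b :: s2) -> D (s1 ++ s2) -> D (s1 ++ existT _ v a :: s2).
Hypothesis D_merge : forall s1 v (a : A v) s2 (b : A v) s3,
  all (fun c => e v (tag c)) s2 -> exists c : A v,
  D (s1 ++ s2 ++ existT _ v c :: s3) ->
  D (s1 ++ existT _ v a :: s2 ++ existT _ v b :: s3).
Hypothesis D_reduced : forall s, (forall a, List.In a s -> centered (tagged a)) ->
  greduced e (map tag s) -> D s.

(** Strong induction on the length, and inside it an induction that centers the letters from left to
    right. Centering leaves a word with one letter fewer to the outer induction; a fully centered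
    word is either reduced or has two letters to merge, which shortens it. *)
Lemma graph_word_ind s : D s.
Proof.
have [m] := ubnP (size s); elim: m s => // m IH s; rewrite ltnS => sm.
suff centered_prefix s2 s1 : (size (s1 ++ s2) <= m)%N ->
    (forall a, List.In a s1 -> centered (tagged a)) -> D (s1 ++ s2).
  exact: (centered_prefix s [::]).
elim: s2 s1 => [|[v a] s2 IHs2] s1.
  rewrite cats0 => s1m s1c; case: (boolP (greduced e (map tag s1))) => [|/greduced_mapPn].
    exact: D_reduced.
  move=> [t1 [[v a] [t2 [[u b] [t3 [def_s1 /= uv t2v]]]]]]; subst u.
  have [c] := D_merge t1 a b t3 t2v; rewrite -def_s1; apply; apply: IH.
  by move: s1m; rewrite def_s1 !size_cat /= !size_cat /= !addnS.
move=> s1m s1c; have [b bc] := D_center s1 a s2; apply.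
  rewrite -cat_rcons; apply: IHs2; first by move: s1m; rewrite !size_cat size_rcons addnS.
  move=> c; rewrite -cats1 List.in_app_iff => -[/s1c // | [<- //|[]]].
by apply: IH; move: s1m; rewrite !size_cat addnS.
Qed.
End WordInduction.

(** * Asymptotic graph independence of the dilated microstates *)

Section GraphProduct.
Variables (R : realType) (V : finType) (e : rel V).
Hypotheses (e_sym : symmetric e) (e_irr : irreflexive e).
Variables (Mv : V -> tracialVN R) (M : tracialVN R).
Variables (N : V -> set (tvn_space M -> tvn_space M))
  (iota : forall v : V, (tvn_space (Mv v) -> tvn_space (Mv v)) ->
                        (tvn_space M -> tvn_space M)).
Hypothesis N_indep : graph_independent e N.
Hypothesis iotaP : forall v, tracial_isomorphism_onto (N v) (@iota v).
Variables (J : V -> Type) (x : forall v, J v -> (tvn_space (Mv v) -> tvn_space (Mv v))).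
Hypothesis xM : forall v j, tvn_alg (Mv v) (x j).
Variables (n : V -> nat -> nat) (X : forall v k, J v -> 'M[R[i]]_(n v k)).
Hypothesis X_bound : forall v j, exists K, forall k, opbound K (X k j : 'M[R[i]]_(n v k)).
Hypothesis X_cvg : forall v (P : ncpoly R[i] (J v)),
  diag_cvg (fun k => ncpoly_mx (@X v k) P) (tvn_trace (Mv v) (ncpoly_op (@x v) P)).
Variable w : forall k, walk_model e (n^~ k) k.

Local Notation sym := {v : V & ncpoly R[i] (J v)}.
Local Notation sym_of v P := (existT (fun v => ncpoly R[i] (J v)) v P).

Definition sym_mx k (a : sym) : {v : V & 'M[R[i]]_(n v k)} :=
  existT (fun v => 'M[R[i]]_(n v k)) (tag a) (ncpoly_mx (@X (tag a) k) (tagged a)).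
Definition word_mx k (s : seq sym) := dilate_prod (w k) (map (sym_mx k) s).
Definition sym_op (a : sym) := iota (ncpoly_op (@x (tag a)) (tagged a)).
Definition word_op (s : seq sym) :=
  foldr (fun S T => S \o T) idfun (map sym_op s).

Definition word_cvg s := diag_cvg (fun k => word_mx k s) (tvn_trace M (word_op s)).

Lemma iota_mem v T : tvn_alg (Mv v) T -> N v (iota T).
Proof. by case: (ti_bij (iotaP v)) => sub _ _; exact: sub. Qed.

Lemma sym_op_mem a : N (tag a) (sym_op a).
Proof. by apply: iota_mem; exact: ncpoly_op_mem. Qed.

Lemma sym_op_alg a : tvn_alg M (sym_op a).
Proof. by apply: gi_sub N_indep _ _ _; exact: sym_op_mem. Qed.

Lemma word_op_alg s : tvn_alg M (word_op s).
Proof.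
elim: s => [|a s IH]; first exact: tvn_1.
by apply: tvn_mul IH; exact: sym_op_alg.
Qed.

Lemma word_op_cat s t : word_op (s ++ t) = word_op s \o word_op t.
Proof. by elim: s => [|a s IH] //=; rewrite /word_op /= in IH *; rewrite IH. Qed.

Lemma word_mx_cons k a s :
  word_mx k (a :: s) = dilate (w k) (ncpoly_mx (@X (tag a) k) (tagged a)) *m word_mx k s.
Proof. by []. Qed.

Lemma word_mx_cat k s t : word_mx k (s ++ t) = word_mx k s *m word_mx k t.
Proof.
elim: s => [|a s IH]; first by rewrite mul1mx.
by rewrite cat_cons !word_mx_cons IH mulmxA.
Qed.

Definition nc_center v (P : ncpoly R[i] (J v)) : ncpoly R[i] (J v) :=
  (- tvn_trace (Mv v) (ncpoly_op (@x v) P), [::]) :: P.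

(** The letter is its trace plus its centered part, so the word is a linear combination of the two
    given ones, for operators and matrices alike. *)
Lemma word_cvg_center s1 v (P : ncpoly R[i] (J v)) s2 :
  word_cvg (s1 ++ sym_of v (nc_center P) :: s2) -> word_cvg (s1 ++ s2) ->
  word_cvg (s1 ++ sym_of v P :: s2).
Proof.
set c := tvn_trace (Mv v) (ncpoly_op (@x v) P) => cvg1 cvg0.
have := diag_cvg_linear c cvg0 cvg1; rewrite -tvn_trace_lin; try exact: word_op_alg.
have -> : c *: word_op (s1 ++ s2) + word_op (s1 ++ sym_of v (nc_center P) :: s2) =
          word_op (s1 ++ sym_of v P :: s2).
  rewrite !word_op_cat -tvn_comp_linear; last exact: word_op_alg.
  congr (_ \o _).
  suff opE : sym_op (sym_of v P) = c *: idfun + sym_op (sym_of v (nc_center P)).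
    by rewrite -[word_op (sym_of v P :: s2)]/(sym_op _ \o word_op s2) opE.
  rewrite /sym_op /= -(ti_one (iotaP v)) -(ti_linear (iotaP v)); last 2 first.
  - exact: tvn_1.
  - exact: ncpoly_op_mem.
  rewrite ncpoly_op_cons /= -/c; congr iota.
  by rewrite addrA -scalerDl subrr scale0r add0r.
have -> : (fun k => c *: word_mx k (s1 ++ s2) + word_mx k (s1 ++ sym_of v (nc_center P) :: s2))
   = (fun k => word_mx k (s1 ++ sym_of v P :: s2)).
  apply: functional_extensionality_dep => k.
  rewrite !word_mx_cat !word_mx_cons scalemxAr -mulmxDr; congr (_ *m _).
  have -> : ncpoly_mx (@X v k) P = c *: 1%:M + ncpoly_mx (@X v k) (nc_center P).
    by rewrite ncpoly_mx_cons /= -/c scaleNr addrA subrr add0r.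
  by rewrite dilate_linear dilate1 mulmxDl -scalemxAl mul1mx.
by [].
Qed.

(** Carrying [P] across the commuting letters [s2] and multiplying it with [Q] changes neither the
    matrices nor the operator, so the two statements are equal. *)
Lemma word_cvg_merge s1 v (P : ncpoly R[i] (J v)) s2 (Q : ncpoly R[i] (J v)) s3 :
  all (fun c => e v (tag c)) s2 ->
  word_cvg (s1 ++ s2 ++ sym_of v (ncmul P Q) :: s3) ->
  word_cvg (s1 ++ sym_of v P :: s2 ++ sym_of v Q :: s3).
Proof.
move=> s2v.
have -> : word_cvg (s1 ++ sym_of v P :: s2 ++ sym_of v Q :: s3) =
   diag_cvg (fun k => word_mx k (s1 ++ s2 ++ sym_of v (ncmul P Q) :: s3))
    (tvn_trace M (word_op (s1 ++ s2 ++ sym_of v (ncmul P Q) :: s3))); last by [].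
rewrite /word_cvg; congr (diag_cvg _ (tvn_trace M _)).
  apply: functional_extensionality_dep => k.
  rewrite !word_mx_cat !word_mx_cons !word_mx_cat !word_mx_cons /=.
  rewrite ncpoly_mx_mul dilateM.
  congr (_ *m _); rewrite !mulmxA; congr (_ *m _ *m _).
  elim: s2 s2v => [|a s IH] /=; first by rewrite mul1mx mulmx1.
  move=> /andP[va sv]; rewrite word_mx_cons mulmxA (dilateC (w k) _ _ e_sym va).
  by rewrite -mulmxA IH // mulmxA.
have comm : sym_op (sym_of v P) \o word_op s2 = word_op s2 \o sym_op (sym_of v P).
  elim: s2 s2v => [|a s IH] //= /andP[va sv].
  rewrite -[word_op _]/(sym_op a \o word_op s) compA.
  rewrite (gi_comm N_indep va (sym_op_mem (sym_of v P)) (sym_op_mem a)).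
  by rewrite -compA IH.
rewrite !word_op_cat; congr (_ \o _).
rewrite -[LHS]/((sym_op (sym_of v P)) \o (word_op (s2 ++ sym_of v Q :: s3))).
rewrite word_op_cat compA comm -compA; congr (_ \o _).
rewrite -![word_op (_ :: _)]/(sym_op _ \o word_op s3) compA; congr (_ \o _).
by rewrite /sym_op /= ncpoly_op_mul // (ti_mul (iotaP v)) //; exact: ncpoly_op_mem.
Qed.
Definition centered v (P : ncpoly R[i] (J v)) : Prop :=
  tvn_trace (Mv v) (ncpoly_op (@x v) P) = 0.

Lemma nc_center_centered v (P : ncpoly R[i] (J v)) : centered (nc_center P).
Proof.
rewrite /centered /nc_center ncpoly_op_cons tvn_trace_lin.
- by rewrite tvn_trace1 mulr1 addNr.
- exact: tvn_1.
- exact: ncpoly_op_mem.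
Qed.

Lemma greduced_reduced_word (T : Type) (f : T -> V) (s : seq T) :
  greduced e (map f s) -> reduced_word e (fun i : 'I_(size s) => f (tnth (in_tuple s) i)).
Proof.
move=> sred i k ik eq_ik; pose a0 := tnth (in_tuple s) i.
have nthE (j : 'I_(size s)) : nth (f a0) (map f s) j = f (tnth (in_tuple s) j).
  by rewrite (nth_map a0) // (tnth_nth a0).
have := @greduced_nth _ _ e_irr (f a0) _ i k sred ik.
rewrite size_map !nthE => /(_ (ltn_ord k) eq_ik) [j [ijk _ ej]].
have js : (j < size s)%N by case/andP: ijk => _ /ltn_trans; apply.
by exists (Ordinal js); split=> //; rewrite -[j]/(nat_of_ord (Ordinal js)) nthE in ej.
Qed.

Lemma word_op_reduced s : (forall a, List.In a s -> centered (tagged a)) ->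
  (0 < size s)%N -> greduced e (map tag s) -> tvn_trace M (word_op s) = 0.
Proof.
move=> sc s0 sred; rewrite /word_op foldrE big_map big_tnth.
apply: (gi_trace N_indep s0 (greduced_reduced_word sred)) => i.
set a := tnth _ _; have as_ : List.In a s.
  rewrite /a (tnth_nth a) /=; elim: (s) (nat_of_ord i) (ltn_ord i) => [|b t IH] [|j] //=.
    by left.
  by rewrite ltnS => jt; right; exact: IH.
split; first exact: sym_op_mem.
by rewrite (ti_trace (iotaP _)) ?sc //; exact: ncpoly_op_mem.
Qed.

Definition off_diag k (a : {v : V & 'M[R[i]]_(n v k)}) : {v : V & 'M[R[i]]_(n v k)} :=
  existT (fun v => 'M[R[i]]_(n v k)) (tag a) (tagged a - diag_part (tagged a)).
Arguments off_diag : clear implicits.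

Lemma word_mx_bound s : exists K, forall k, opbound K (word_mx k s).
Proof.
elim: s => [|a s [L sL]]; first by exists 1 => k; exact: opbound1.
have [K aK] := opbound_ncpoly (@X_bound (tag a)) (tagged a).
by exists (K * L) => k; apply: opboundM => //; exact: opbound_dilate.
Qed.

(** Letters are replaced one at a time. The new error is a bounded factor times the old error, plus
    the dilated diagonal part times a bounded word; the diagonal part of a centered letter tends to
    zero in 2-norm. *)
Lemma word_mx_off_diag s : (forall a, List.In a s -> centered (tagged a)) ->
  frob (word_mx k s - dilate_prod (w k) (map (off_diag k \o sym_mx k) s))
    / (wm_size (w k))%:R @[k --> \oo] --> (0 : R).
Proof.
elim: s => [|a s IH] sc.
  rewrite (_ : (fun k => _) = fun=> 0); first exact: cvg_cst.
  by apply/funext => k; rewrite subrr frob0 mul0r.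
have [K aK] := opbound_ncpoly (@X_bound (tag a)) (tagged a).
have [L sL] := word_mx_bound s.
pose Z k := dilate_prod (w k) (map (off_diag k \o sym_mx k) s).
pose B k := ncpoly_mx (@X (tag a) k) (tagged a).
have dec k : word_mx k (a :: s) - dilate_prod (w k) (map (off_diag k \o sym_mx k) (a :: s)) =
    dilate (w k) (B k - diag_part (B k)) *m (word_mx k s - Z k)
    + dilate (w k) (diag_part (B k)) *m word_mx k s.
  rewrite word_mx_cons.
  rewrite -[dilate_prod _ (map _ (a :: s))]/(dilate (w k) (B k - diag_part (B k)) *m Z k).
  rewrite mulmxBr addrAC -mulmxDl; congr (_ *m _ - _).
  have := dilate_linear (w k) 1 (B k - diag_part (B k)) (diag_part (B k)).
  by rewrite !scale1r subrK.
pose K' := 2 * (sqmod (-1 : R[i]) * K) + 2 * K.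
have offK k : opbound K' (dilate (w k) (B k - diag_part (B k))).
  apply: opbound_dilate; rewrite addrC -scaleN1r; apply: opboundD; last exact: aK.
  by apply: opboundZ; apply: opbound_diag; exact: aK.
have Ba := @X_cvg (tag a) (tagged a); rewrite [tvn_trace _ _]sc in Ba; last by left.
have sc' b : List.In b s -> centered (tagged b) by move=> bs; apply: sc; right.
apply: squeeze0 (cvg0_lin (2 * K') (2 * L) (IH sc') Ba); apply: nearW => k.
have m0 : 0 < (wm_size (w k))%:R :> R by rewrite ltr0n wm_size_gt0.
rewrite divr_ge0 ?frob_ge0 ?ler0n //= dec.
rewrite -frob_diag_part -(frob_dilate (w k)) !mulrA -mulrDl ler_wpM2r ?invr_ge0 ?ler0n //.
apply: le_trans (frobD _ _) _; rewrite -!mulrA lerD // ler_wpM2l //.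
  exact: opbound_mul.
exact: opbound_mulr.
Qed.

Lemma word_cvg_reduced s : (forall a, List.In a s -> centered (tagged a)) ->
  greduced e (map tag s) -> word_cvg s.
Proof.
case: (posnP (size s)) => [/size0nil -> _ _|s0 sc sred].
  rewrite /word_cvg /diag_cvg tvn_trace1 (_ : (fun k => _) = fun=> 0); first exact: cvg_cst.
  apply/funext => k; rewrite /diag_dist big1 ?mul0r // => i _.
  by rewrite mxE eqxx subrr sqmod0.
rewrite /word_cvg word_op_reduced //.
(* From [k = size s] on, the model [w k] excludes closed walks along reduced words as long as
   [s]. *)
apply: squeeze0 (word_mx_off_diag sc); near=> k.
have Z0 p : dilate_prod (w k) (map (off_diag k \o sym_mx k) s) p p = 0.
  apply: dilate_prod_diag0; rewrite ?size_map //; first last.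
  - by near: k; exact: nbhs_infty_ge.
  - by rewrite -map_comp.
  move=> b; rewrite List.in_map_iff => -[c [<- _]] y /=.
  by rewrite mxE [X in _ + X]mxE diag_partE eqxx subrr.
rewrite diag_dist_ge0 /=; apply: le_trans (diag_dist_frob _).
(* The off-diagonal product has zero diagonal, so subtracting it leaves the diagonal unchanged. *)
suff -> : diag_dist (word_mx k s) 0 =
  diag_dist (word_mx k s - dilate_prod (w k) (map (off_diag k \o sym_mx k) s)) 0 by [].
congr (_ / _); apply: eq_bigr => p _.
by rewrite [in RHS]mxE [X in _ = sqmod (_ + X - _)]mxE Z0 oppr0 !addr0.
Unshelve. all: by end_near. Qed.

Lemma word_cvgT s : word_cvg s.
Proof.
apply: (@graph_word_ind _ e _ centered) => {s}.
- move=> s1 v P s2; exists (nc_center P); first exact: nc_center_centered.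
  exact: word_cvg_center.
- by move=> s1 v P s2 Q s3 s2v; exists (ncmul P Q); exact: word_cvg_merge.
- exact: word_cvg_reduced.
Qed.
End GraphProduct.

(** * Galois bounds and generation *)

Section GaloisBounded.
Variable R : realType.

Lemma galois_id : galois_Qbar (id : R[i] -> R[i]).
Proof. by split=> //; split=> // z Az; exists z. Qed.

Lemma galois0 (sigma : R[i] -> R[i]) : galois_Qbar sigma -> sigma 0 = 0.
Proof.
move=> [_ _ sigmaD _].
have alg0 : algebraic_numbers (0 : R[i]) by exact: algebraic0.
by have := sigmaD 0 0 alg0 alg0; rewrite addr0 => /esym/eqP; rewrite -subr_eq0 addrK => /eqP.
Qed.

Lemma galois_bounded_opbound (n : nat -> nat) (A : forall k, 'M[R[i]]_(n k)) :
  galois_bounded A -> exists K, forall k, opbound K (A k).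
Proof.
(* The bound is taken at the identity automorphism; the maximum with 0 provides the nonnegativity
   that [opbound_opnorm] asks for. *)
move=> [_ [K AK] _]; exists (Num.max K 0 ^+ 2) => k.
apply/opbound_opnorm; first by rewrite le_max lexx orbT.
rewrite le_max; apply/orP; left.
by have := AK k _ galois_id; rewrite map_mx_id.
Qed.

(** The entries of the dilation are entries of [A k] or 0, and automorphisms fix 0, so conjugation
    commutes with dilation; norm bounds and orbit sizes carry over. *)
Lemma galois_bounded_dilate (V : finType) (e : rel V) (n : V -> nat -> nat)
    (w : forall k, walk_model e (n^~ k) k) v (A : forall k, 'M[R[i]]_(n v k)) :
  galois_bounded A -> galois_bounded (fun k => dilate (w k) (A k)).
Proof.
move=> [A_int [K AK] [c Ac]].
have map_dilate k sigma : galois_Qbar sigma ->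
    map_mx sigma (dilate (w k) (A k)) = dilate (w k) (map_mx sigma (A k)).
  by move=> /galois0 s0; apply/matrixP => p q; rewrite !mxE; case: ifP.
split.
- move=> k p q; rewrite mxE; case: ifP => // _; exact: (mxpoly.integral0 intr).
- exists (Num.max K 0) => k sigma Gs; rewrite map_dilate //.
  apply/opbound_opnorm; first by rewrite le_max lexx orbT.
  apply: opbound_dilate; apply/opbound_opnorm; first by rewrite le_max lexx orbT.
  by rewrite le_max AK.
exists c => k; apply: card_le_trans (Ac k).
rewrite (_ : [set _ | _ in _] =
  (fun B => dilate (w k) B) @` [set map_mx sigma (A k) | sigma in @galois_Qbar R]).
  exact: card_image_le.
by rewrite image_comp; apply: eq_imagel => sigma Gs /=; exact: map_dilate.
Qed.
End GaloisBounded.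

Section Generation.
Variables (R : realType) (M M' : tracialVN R).
Variables (N : set (tvn_space M' -> tvn_space M'))
  (iota : (tvn_space M -> tvn_space M) -> (tvn_space M' -> tvn_space M')).
Hypothesis iotaP : tracial_isomorphism_onto N iota.
Hypothesis NM : N `<=` tvn_alg M'.
Variable Q : set (tvn_space M' -> tvn_space M').
Hypothesis QP : von_neumann_algebra Q.

(** Pulls a test algebra for generation back to [M]; its ultraweak closedness comes from the
    normality of [iota]. *)
Lemma preimage_von_neumann_algebra : von_neumann_algebra (tvn_alg M `&` iota @^-1` Q).
Proof.
split.
- by move=> T [MT _]; exact: vna_bounded (tvn_algP M) _ MT.
- by split; [exact: tvn_1 | rewrite /= (ti_one iotaP); exact: vna_one].
- move=> a S T [MS QS] [MT QT]; split; first exact: tvn_lin.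
  by rewrite /preimage /= (ti_linear iotaP) //; exact: vna_linear.
- move=> S T [MS QS] [MT QT]; split; first exact: tvn_mul.
  by rewrite /preimage /= (ti_mul iotaP) //; exact: vna_mul.
- move=> T [MT QT]; split; first exact: tvn_adj.
  by rewrite /preimage /= (ti_adjoint iotaP) //; exact: vna_adjoint.
move=> F T FF FMQ T_bd FT.
have FM : F (tvn_alg M) by apply: filterS FMQ => S [].
have MT : tvn_alg M T by exact: vna_closed (tvn_algP M) _ _ FF FM T_bd FT.
split=> //=; apply: (vna_closed QP (F := iota @ F)).
- by have : F (iota @^-1` Q) by apply: filterS FMQ => S [].
- by case: (ti_bij iotaP) => sub _ _; apply: (vna_bounded (tvn_algP M')); apply: NM; exact: sub.
- exact: ti_normal iotaP _ _ FF FM MT FT.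
Qed.

Lemma generates_preimage (S : set (tvn_space M -> tvn_space M)) :
  vN_generates S (tvn_alg M) -> iota @` S `<=` Q -> iota @` tvn_alg M `<=` Q.
Proof.
move=> [SM gen] SQ _ [T MT <-].
have SQ' : S `<=` tvn_alg M `&` iota @^-1` Q.
  by move=> U SU; split; [exact: SM | apply: SQ; exists U].
by have [] := gen _ preimage_von_neumann_algebra SQ' _ MT.
Qed.
End Generation.

(** * Microstates for finite subtuples of the graph product *)

Theorem theorem3 (R : realType) (V : finType) (e : rel V)
    (e_sym : symmetric e) (e_irr : irreflexive e)
    (Mv : V -> tracialVN R) (M : tracialVN R)
    (M_graph_product : is_graph_product e Mv M)
    (Mv_sofic : forall v : V, algebraically_sofic (Mv v)) :
  algebraically_sofic M.
Proof.
have [N [iota [N_indep iotaP M_gen]]] := M_graph_product.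
pose I v : Type := projT1 (cid (Mv_sofic v)).
have soficI v : exists x : I v -> (tvn_space (Mv v) -> tvn_space (Mv v)),
    [/\ forall i, tvn_alg (Mv v) (x i), vN_generates (range x) (tvn_alg (Mv v))
      & algebraically_sofic_tuple x] := projT2 (cid (Mv_sofic v)).
pose x v := projT1 (cid (soficI v)).
have xP v : [/\ forall i, tvn_alg (Mv v) (x v i),
    vN_generates (range (x v)) (tvn_alg (Mv v)) & algebraically_sofic_tuple (x v)]
  := projT2 (cid (soficI v)).
have xM v i : tvn_alg (Mv v) (x v i) by have [] := xP v.
have NM v : N v `<=` tvn_alg M := @gi_sub _ _ _ _ _ N_indep v.
have iotaN v T : tvn_alg (Mv v) T -> N v (iota v T).
  by case: (ti_bij (iotaP v)) => sub _ _; exact: sub.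
(* The generators of all the [Mv v], moved into [M] and indexed by the disjoint union. *)
pose y (i : {v : V & I v}) := iota (tag i) (x (tag i) (tagged i)).
have yM i : tvn_alg M (y i) by apply: NM; apply: iotaN; exact: xM.
exists {v : V & I v}, y; split=> //.
  split; first by move=> _ [i _ <-]; exact: yM.
  (* It suffices that [Q] contains every [N v], onto which [iota v] maps the algebra generated by
     [x v]. *)
  move=> Q QP yQ; apply: (M_gen.2 _ QP) => T [v _ NT].
  have [_ _ surj] := ti_bij (iotaP v); have [U MU <-] := surj _ NT.
  have [_ x_gen _] := xP v.
  apply: (generates_preimage (iotaP v) (NM v) QP x_gen) => [_ [_ [i _ <-] <-]|].
    by apply: yQ; exists (existT _ v i).
  by exists U.
move=> F F_fin; pose Fv v : set (I v) := [set j | F (existT _ v j)].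
have Fv_fin v : finite_set (Fv v).
  apply: (finite_preimage _ F_fin) => j k _ _.
  by apply: Eqdep_dec.inj_pair2_eq_dec; exact: eq_comparable.
have soficF v : exists nX : {n : nat -> nat & forall k, Fv v -> 'M[R[i]]_(n k)},
    [/\ forall k, (0 < projT1 nX k)%N,
      forall i, galois_bounded (fun k => projT2 nX k i),
      microstates (fun i : Fv v => x v (val i)) (projT2 nX) &
      forall P : ncpoly R[i] (Fv v),
        asymptotically_constant_on_diagonal (fun k => ncpoly_mx (projT2 nX k) P)].
  by have [_ _ /(_ _ (Fv_fin v)) [n [X XP]]] := xP v; exists (existT _ n X).
pose n v := projT1 (projT1 (cid (soficF v))).
pose X v k : Fv v -> 'M[R[i]]_(n v k) := projT2 (projT1 (cid (soficF v))) k.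
have nX v : [/\ forall k, (0 < n v k)%N, forall i, galois_bounded (fun k => X v k i),
      microstates (fun i : Fv v => x v (val i)) (X v) &
      forall P : ncpoly R[i] (Fv v),
        asymptotically_constant_on_diagonal (fun k => ncpoly_mx (X v k) P)]
  := projT2 (cid (soficF v)).
have n0 v k : (0 < n v k)%N by have [] := nX v.
(* The excluded loop length is [k] itself, so that it eventually exceeds the length of any fixed
   word. *)
pose w k : walk_model e (n^~ k) k :=
  projT1 (cid (walk_model_exists k e_sym e_irr (n0^~ k))).
have toF (i : F) : {j : Fv (tag (val i)) | val j = tagged (val i)}.
  by case: i => -[v j] /= Fj; exists (exist _ j (mem_set (set_mem Fj))).
pose Y k (i : F) := dilate (w k) (X (tag (val i)) k (sval (toF i))).
pose xF v (j : Fv v) := x v (val j).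
have xFM v j : tvn_alg (Mv v) (xF v j) by exact: xM.
have Xb v j : exists K, forall k, opbound K (X v k j).
  by have [_ gb _ _] := nX v; exact: galois_bounded_opbound (gb j).
have Xc v (P : ncpoly R[i] (Fv v)) :
    diag_cvg (fun k => ncpoly_mx (X v k) P) (tvn_trace (Mv v) (ncpoly_op (xF v) P)).
  by apply/(diag_cvgP _ _ (n0 v)); have [_ _ mX aX] := nX v; split; [exact: mX | exact: aX].
(* A letter over [F] as a one-term polynomial at its vertex; monomials thereby become words covered
   by [word_cvgT]. *)
pose sym (l : F * bool) : {v : V & ncpoly R[i] (Fv v)} :=
  existT _ (tag (val l.1)) [:: (1, [:: (sval (toF l.1), l.2)])].
have sym_mxE s k : word_mx X w k (map sym s) = mx_monomial (Y k) s.
  elim: s => [|[i b] s IH] //; rewrite map_cons word_mx_cons IH; congr (_ *m _).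
  rewrite /= ncpoly_mx_cons ncpoly_mx_nil addr0 scale1r /mx_monomial /= mulmx1.
  by case: b => //; rewrite /mx_letter /= dilate_adj.
have sym_opE s : word_op iota xF (map sym s) = op_monomial (fun i : F => y (val i)) s.
  elim: s => [|[i b] s IH] //; rewrite -[RHS]/(op_letter _ (i, b) \o op_monomial _ s) -IH.
  congr (_ \o _); rewrite /sym_op /= ncpoly_op_cons ncpoly_op_nil addr0 scale1r.
  rewrite /op_monomial /= -[X in iota _ X]/(op_letter (xF _) (_, b)).
  rewrite /op_letter /= /y /xF /= (svalP (toF i)).
  by case: b => //; rewrite (ti_adjoint (iotaP _)).
have Yc (P : ncpoly R[i] F) :
    diag_cvg (fun k => ncpoly_mx (Y k) P) (tvn_trace M (ncpoly_op (fun i : F => y (val i)) P)).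
  elim: P => [|[c s] P IH].
    rewrite ncpoly_op_nil tvn_trace0 /diag_cvg (_ : (fun k => _) = fun=> 0); first exact: cvg_cst.
    apply/funext => k; rewrite ncpoly_mx_nil /diag_dist big1 ?mul0r // => p _.
    by rewrite mxE subrr sqmod0.
  rewrite ncpoly_op_cons tvn_trace_lin; first last.
  - by apply: ncpoly_op_mem => i; exact: yM.
  - by apply: op_monomial_mem => i; exact: yM.
  rewrite -sym_opE; have := word_cvgT e_sym e_irr N_indep iotaP xFM Xb Xc w (map sym s).
  move=> /(diag_cvg_linear c) /(_ IH).
  suff -> : (fun k => c *: word_mx X w k (map sym s) + ncpoly_mx (Y k) P) =
    (fun k => ncpoly_mx (Y k) ((c, s) :: P)) by [].
  by apply: functional_extensionality_dep => k; rewrite sym_mxE ncpoly_mx_cons.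
exists (fun k => wm_size (w k)), Y; split.
- by move=> k; exact: wm_size_gt0.
- by move=> i; apply: galois_bounded_dilate; have [_ + _ _] := nX (tag (val i)); apply.
- by move=> P; have /(diag_cvgP _ _ (fun k => wm_size_gt0 (w k))) [] := Yc P.
- by move=> P; have /(diag_cvgP _ _ (fun k => wm_size_gt0 (w k))) [] := Yc P.
Qed.
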